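(* Let $(\sigma,\boldsymbol v)\in C^1([0,T],H(\mathbf{div},\Omega,S))\times C^1([0,T],L^2(\Omega)^d)$ be the solution of the weak problem, and let $(\sigma_h,\boldsymbol v_h)\in C^1([0,T],\mathrm H_h)\times C^1([0,T],\mathrm V_h)$ be the solution of the semi-discrete problem with initial data $\psi_{0,h}=I_{\mathrm H_h}\psi_0$, $\phi_{1,h}=I_{\mathrm V_h}\phi_1$. Let $l,m,m'\ge0$ be integers and assume that, for some constant independent of $h$ (again denoted $C$ in each inequality), the following hold. Discrete inf-sup condition: $$\|\boldsymbol w_h\|_0\le C\sup_{0\ne\tau_h\in\mathrm H_h}\frac{b(\boldsymbol w_h,\tau_h)}{\|\tau_h\|_{\mathbf{div}}}\qquad\text{for all }\boldsymbol w_h\in\mathrm V_h.$$ Regularity: $\sigma\in L^\infty([0,T],H^m(\Omega)^{d\times d})$, $\sigma_t\in L^2([0,T],H^m(\Omega)^{d\times d})$, $\boldsymbol v\in L^\infty([0,T],H^{m'}(\Omega)^d)$, $\boldsymbol v_t\in L^2([0,T],H^{m'}(\Omega)^d)$. Approximation by the elliptic projection $(\hat\sigma_h,\hat{\boldsymbol v}_h)$ of $(\sigma,\boldsymbol v)$: in $t$, $$\|\hat\sigma_h-\sigma\|_0+\|\hat{\boldsymbol v}_h-\boldsymbol v\|_0\le Ch^l(\|\sigma\|_m+\|\boldsymbol v\|_{m'}),\qquad \|\hat\sigma_{h,t}-\sigma_t\|_0+\|\hat{\boldsymbol v}_{h,t}-\boldsymbol v_t\|_0\le Ch^l(\|\sigma_t\|_m+\|\boldsymbol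 v_t\|_{m'}).$$ Interpolation estimate: $\psi_0\in H^l(\Omega)^{d\times d}$, $\phi_1\in H^l(\Omega)^d$, and $$\|\psi_0-I_{\mathrm H_h}\psi_0\|_0\le Ch^l\|\psi_0\|_l,\qquad \|\phi_1-I_{\mathrm V_h}\phi_1\|_0\le Ch^l\|\phi_1\|_l.$$ Then there is a constant $C>0$ independent of $h$ such that $$\|\sigma-\sigma_h\|_{L^\infty([0,T],L^2)}+\|\boldsymbol v-\boldsymbol v_h\|_{L^\infty([0,T],L^2)}\le C h^l\big(\|\psi_0\|_l+\|\phi_1\|_l+\|\sigma\|_{L^\infty(H^m)}+\|\sigma_t\|_{L^2(H^m)}+\|\boldsymbol v\|_{L^\infty(H^{m'})}+\|\boldsymbol v_t\|_{L^2(H^{m'})}\big).$$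
   Context: Setting. $d\in\{2,3\}$, $\Omega\subset\mathbb R^d$ is a bounded convex polyhedral domain, $T>0$. $\|\cdot\|_r$ is the norm of $H^r(\Omega)$ (scalar, vector or tensor valued), with $H^0=L^2$; subscript $t$ or $\partial_t$ denotes the time derivative. For a normed space $X$ of functions on $\Omega$, $\|\cdot\|_{L^p(X)}$ is the norm of $L^p([0,T];X)$. $\rho(\boldsymbol x)$ is a scalar function with $0<\rho_0\le\rho\le\rho_1<\infty$ a.e. in $\Omega$; $\mathbb C=\mathbb C(\boldsymbol x)$ is a rank 4 symmetric tensor with $M_0\,\tau:\tau\le\mathbb C^{-1}\tau:\tau\le M_1\,\tau:\tau$ for all symmetric $\tau\in\mathbb R^{d\times d}$ and a.e. $\boldsymbol x$, where $M_0,M_1>0$ and $\sigma:\tau=\sum_{i,j}\sigma_{ij}\tau_{ij}$. $\boldsymbol f\in C^0([0,T],L^2(\Omega)^d)$. $H(\mathbf{div},\Omega,S)=\{\tau\in L^2(\Omega)^{d\times d}:\tau_{ij}=\tau_{ji},\ \mathbf{div}\,\tau\in L^2(\Omega)^d\}$ (row-wise divergence), $\|\tau\|_{\mathbf{div}}^2=\|\tau\|_0^2+\|\mathbf{div}\,\tau\|_0^2$. Define $a(\sigma,\tau)=\int_\Omega\mathbb C^{-1}\sigma:\tau\,d\boldsymbol x$, $b(\boldsymbol v,\tau)=\int_\Omega\boldsymbol v\cdot\mathbf{div}\,\tau\,d\boldsymbol x$, $c(\boldsymbol v,\boldsymbol w)=\int_\Omega\rho\,\boldsymbol v\cdot\boldsymbol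 w\,d\boldsymbol x$, and $(\cdot,\cdot)$ the $L^2$ inner product. Weak problem: $a(\sigma_t,\tau)+a(\sigma,\tau)+b(\boldsymbol v,\tau)=0$ for all $\tau\in H(\mathbf{div},\Omega,S)$; $c(\boldsymbol v_t,\boldsymbol w)-b(\boldsymbol w,\sigma)=(\boldsymbol f,\boldsymbol w)$ for all $\boldsymbol w\in L^2(\Omega)^d$; $\boldsymbol v(\cdot,0)=\phi_1$, $\sigma(\cdot,0)=\psi_0$. Discretization. $\mathcal T_h$ is a shape regular partition of $\Omega$ into triangles/tetrahedra or rectangles/cuboids, $h$ the maximal element diameter. $\mathrm H_h\subset H(\mathbf{div},\Omega,S)$ and $\mathrm V_h\subset L^2(\Omega)^d$ are finite-dimensional spaces on $\mathcal T_h$. $I_{\mathrm H_h}:H(\mathbf{div},\Omega,S)\to\mathrm H_h$ and $I_{\mathrm V_h}:L^2(\Omega)^d\to\mathrm V_h$ are interpolation operators. Semi-discrete problem: $a(\sigma_{h,t},\tau_h)+a(\sigma_h,\tau_h)+b(\boldsymbol v_h,\tau_h)=0$ for all $\tau_h\in\mathrm H_h$; $c(\boldsymbol v_{h,t},\boldsymbol w_h)-b(\boldsymbol w_h,\sigma_h)=(\boldsymbol f,\boldsymbol w_h)$ for all $\boldsymbol w_h\in\mathrm V_h$; $\boldsymbol v_h(\cdot,0)=\phi_{1,h}$, $\sigma_h(\cdot,0)=\psi_{0,h}$. Elliptic projection: for $t\in[0,T]$, $(\hat\sigma_h(t),\hat{\boldsymbol v}_h(t))\in\mathrm H_h\times\mathrm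 V_h$ is the solution (unique under the discrete inf-sup condition) of $a(\hat\sigma_h(t),\tau_h)+b(\hat{\boldsymbol v}_h(t),\tau_h)=-a(\partial_t\sigma(t),\tau_h)$ for all $\tau_h\in\mathrm H_h$ and $b(\boldsymbol w_h,\hat\sigma_h(t))=b(\boldsymbol w_h,\sigma(t))=c(\boldsymbol v_t(t),\boldsymbol w_h)-(\boldsymbol f(t),\boldsymbol w_h)$ for all $\boldsymbol w_h\in\mathrm V_h$. *)

(* Defs.v *)
From HB Require Import structures.
From mathcomp Require Import all_boot all_order all_algebra.
From mathcomp Require Import all_classical all_reals all_analysis.

Set Implicit Arguments.
Unset Strict Implicit.
Unset Printing Implicit Defensive.

Import Order.TTheory GRing.Theory Num.Theory.
Import numFieldNormedType.Exports.

Local Open Scope classical_set_scope.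
Local Open Scope ring_scope.

(* Borel sigma-algebra and Lebesgue measure on R^n = 'rV[R]_n, obtained by
   iterating the library's product measure. *)

Section measurable_rV.
Context (R : realType) (n : nat).

Let coor (i : 'I_n) (x : 'rV[R]_n) : R := x ord0 i.

Let rV_set0 : g_sigma_preimage coor set0.
Proof. exact: sigma_algebra0. Qed.

Let rV_setC A : g_sigma_preimage coor A -> g_sigma_preimage coor (~` A).
Proof. exact: sigma_algebraC. Qed.

Let rV_bigcup (F : _^nat) : (forall i, g_sigma_preimage coor (F i)) ->
  g_sigma_preimage coor (\bigcup_i (F i)).
Proof. exact: sigma_algebra_bigcup. Qed.

HB.instance Definition _ := @isMeasurable.Build default_measure_display
  'rV[R]_n (g_sigma_preimage coor) rV_set0 rV_setC rV_bigcup.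

Lemma measurable_coor (i : 'I_n) :
  measurable_fun setT (fun x : 'rV[R]_n => x ord0 i).
Proof.
move=> _ Y mY; rewrite setTI; apply: sub_sigma_algebra.
rewrite -bigcup_seq/=; exists i => /=; first by rewrite mem_index_enum.
by exists Y => //; rewrite setTI.
Qed.

Lemma measurable_fun_rV d (U : measurableType d) (f : U -> 'rV[R]_n) :
  (forall i, measurable_fun setT (fun x => f x ord0 i)) ->
  measurable_fun setT f.
Proof.
move=> mf.
suff: g_sigma_preimage (fun i => coor i \o f) `<=` measurable.
  by rewrite g_sigma_preimage_comp => H _ A mA; apply: H; exists A.
apply: smallest_sub; first exact: sigma_algebra_measurable.
move=> A; rewrite -bigcup_seq /= => -[i _ [B mB <-]].
exact: (mf i measurableT B mB).
Qed.

End measurable_rV.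

Lemma sigma_finite_prod d1 d2 (T1 : measurableType d1) (T2 : measurableType d2)
    (R : realType) (m1 : {sigma_finite_measure set T1 -> \bar R})
    (m2 : {sigma_finite_measure set T2 -> \bar R}) :
  sigma_finite setT (m1 \x m2)%E.
Proof.
have /sigma_finiteP[F [TF ndF Foo]] := sigma_finiteT m1.
have /sigma_finiteP[G [TG ndG Goo]] := sigma_finiteT m2.
exists (fun n => F n `*` G n).
  rewrite -setXTT TF TG predeqE => -[x y]; split.
    move=> [/= [n _ Fnx] [k _ Gky]]; exists (maxn n k) => //; split.
    - by move: x Fnx; exact/subsetPset/ndF/leq_maxl.
    - by move: y Gky; exact/subsetPset/ndG/leq_maxr.
  by move=> [n _ []/= ? ?]; split; exists n.
move=> k; have [? ?] := Foo k; have [? ?] := Goo k.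
split; first exact: measurableX.
by rewrite product_measure1E// lte_mul_pinfty// ge0_fin_numE.
Qed.

Section lebesgue_step.
Context (R : realType) (n : nat).
Variable mu : {sigma_finite_measure set 'rV[R]_n -> \bar R}.

Definition cons_rV (p : R * 'rV[R]_n) : 'rV[R]_n.+1 := row_mx p.1%:M p.2.

Lemma measurable_cons_rV : measurable_fun setT cons_rV.
Proof.
apply: measurable_fun_rV => i; rewrite /cons_rV.
case: (@split_ordP 1 n i) => j ->.
  rewrite (_ : (fun _ => _) = fst); first exact: measurable_fst.
  by apply/funext => x; rewrite [LHS]row_mxEl mxE !ord1 eqxx mulr1n.
rewrite (_ : (fun _ => _) = (fun v : 'rV[R]_n => v ord0 j) \o snd); last first.
  by apply/funext => x; rewrite [LHS]row_mxEr.
by apply: measurableT_comp; [exact: measurable_coor|exact: measurable_snd].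
Qed.

Definition lebesgue_step : set 'rV[R]_n.+1 -> \bar R :=
  pushforward (@lebesgue_measure R \x mu)%E cons_rV.

Let step0 : lebesgue_step set0 = 0%E.
Proof. by rewrite /lebesgue_step /pushforward preimage_set0 measure0. Qed.

Let step_ge0 A : (0 <= lebesgue_step A)%E.
Proof. exact: (measure_ge0 (@lebesgue_measure R \x mu)%E). Qed.

Let step_sigma_additive : semi_sigma_additive lebesgue_step.
Proof.
refine (@measure_semi_sigma_additive _ _ _
  (pushforward (@lebesgue_measure R \x mu)%E cons_rV : {measure set _ -> \bar R})).
exact: measurable_cons_rV.
Qed.

HB.instance Definition _ := isMeasure.Build _ _ _ lebesgue_step
  step0 step_ge0 step_sigma_additive.

Let step_sigma_finite : sigma_finite setT lebesgue_step.
Proof.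
have [F FT Foo] : sigma_finite setT (@lebesgue_measure R \x mu)%E.
  exact: sigma_finite_prod.
pose g (v : 'rV[R]_n.+1) := (v ord0 ord0, rsubmx (v : 'rV_(1 + n))).
have mg : measurable_fun setT g.
  apply/measurable_fun_pairP; split; first exact: measurable_coor.
  apply: measurable_fun_rV => i /=.
  rewrite (_ : (fun _ => _) =
    fun v : 'rV[R]_n.+1 => v ord0 (rshift 1 i)); first exact: measurable_coor.
  by apply/funext => v; rewrite mxE.
exists (fun k => g @^-1` F k); first by rewrite -preimage_bigcup -FT.
move=> k; have [mF Fk] := Foo k.
split; first by rewrite -[X in measurable X]setTI; exact: mg.
rewrite /lebesgue_step /pushforward -comp_preimage (_ : g \o cons_rV = id)//.
apply/funext => -[x v]; rewrite /g /cons_rV /= row_mxKr; congr pair.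
rewrite (_ : ord0 = lshift n (ord0 : 'I_1)); last exact/val_inj.
by rewrite [LHS]row_mxEl mxE eqxx mulr1n.
Qed.

HB.instance Definition _ := Measure_isSigmaFinite.Build _ _ _ lebesgue_step
  step_sigma_finite.

End lebesgue_step.

Fixpoint lebesgue_rV (R : realType) (n : nat) :
    {sigma_finite_measure set 'rV[R]_n -> \bar R} :=
  match n with
  | 0 => [the {sigma_finite_measure set 'rV[R]_0 -> \bar R}
          of \d_(0 : 'rV[R]_0)]
  | n'.+1 => [the {sigma_finite_measure set 'rV[R]_n'.+1 -> \bar R}
              of lebesgue_step (lebesgue_rV R n')]
  end.

(* Matrices carry the Frobenius product; a vector of R^d is a 1 x d matrix, so
   that fnorm is also the Euclidean norm of R^d. *)

Definition frob (R : realType) p q (A B : 'M[R]_(p, q)) : R :=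
  \sum_i \sum_j A i j * B i j.

Definition fnorm (R : realType) p q (A : 'M[R]_(p, q)) : R :=
  Num.sqrt (frob A A).

Definition tensor4 (R : realType) (d : nat) := 'I_d -> 'I_d -> 'I_d -> 'I_d -> R.

Definition tapp (R : realType) d (C : tensor4 R d) (t : 'M[R]_d) : 'M[R]_d :=
  \matrix_(i, j) \sum_k \sum_l C i j k l * t k l.

Definition symmetric4 (R : realType) d (C : tensor4 R d) :=
  forall i j k l, C i j k l = C j i k l /\ C i j k l = C k l i j.

(* A is the inverse of C as an operator on symmetric matrices; with the
   symmetries imposed on A, it is uniquely determined by C. *)
Definition inverse4 (R : realType) d (C A : tensor4 R d) :=
  symmetric4 A /\
  forall t : 'M[R]_d, t^T = t -> tapp A (tapp C t) = t /\ tapp C (tapp A t) = t.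

Section domain.
Context (R : realType) (d : nat).
Implicit Types (Om K : set 'rV[R]_d) (Th : seq (set 'rV[R]_d)).

Definition convex_polyhedral_domain Om :=
  [/\ Om !=set0,
      (exists M : R, forall x, Om x -> fnorm x <= M) &
      exists n (A : 'I_n -> 'rV[R]_d) (b : 'I_n -> R),
        Om = [set x | forall i, frob (A i) x < b i]].

(* Triangles and rectangles for d = 2, tetrahedra and cuboids (in any
   orientation) for d = 3. *)
Definition is_simplex K :=
  exists p : 'I_d.+1 -> 'rV[R]_d,
    (\det (\matrix_(i < d) (p (lift ord0 i) - p ord0)) != 0) /\
    K = [set x | exists c : 'I_d.+1 -> R,
          [/\ forall i, 0 <= c i, \sum_i c i = 1 & x = \sum_i c i *: p i]].

Definition is_box K :=
  exists (p : 'rV[R]_d) (e : 'I_d -> 'rV[R]_d),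
    [/\ forall i, e i != 0, forall i j, i != j -> frob (e i) (e j) = 0 &
        K = [set x | exists c : 'I_d -> R,
          (forall i, 0 <= c i <= 1) /\ x = p + \sum_i c i *: e i]].

Definition partition_of Om Th :=
  [/\ (forall i, (i < size Th)%N -> is_simplex (nth set0 Th i)) \/
      (forall i, (i < size Th)%N -> is_box (nth set0 Th i)),
      \big[setU/set0]_(K <- Th) K = closure Om &
      forall i j, (i < j < size Th)%N ->
        interior (nth set0 Th i) `&` interior (nth set0 Th j) = set0].

Definition diam K : R := sup [set fnorm (x.1 - x.2) | x in K `*` K].

Definition inradius K : R :=
  sup [set r | 0 <= r /\ exists c, forall x, fnorm (x - c) <= r -> K x].

Definition mesh_size Th : R := \big[Num.max/0]_(K <- Th) diam K.

Definition shape_regular (kappa : R) Th :=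
  forall i, (i < size Th)%N ->
    diam (nth set0 Th i) <= kappa * inradius (nth set0 Th i).

End domain.

Section spaces.
Context (R : realType) (d : nat) (Om : set 'rV[R]_d).

Let mu : {measure set 'rV[R]_d -> \bar R} := lebesgue_rV R d.

Definition field (p q : nat) := 'rV[R]_d -> 'M[R]_(p, q).

(* L^2(Om); functions are identified through the seminorm, not by a quotient. *)

Definition L2norm p q (f : field p q) : \bar R :=
  'N[mu]_(2%:E) [(fun x => (fnorm (f x))%:E) \_ Om]%E.

Definition in_L2 p q : set (field p q) :=
  [set f : field p q | (forall i j, measurable_fun Om (fun x => f x i j)) /\
           (L2norm f < +oo)%E].

Definition partial (i : 'I_d) (f : 'rV[R]_d -> R) : 'rV[R]_d -> R :=
  'D_(delta_mx ord0 i) f.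

Definition partials (s : seq 'I_d) (f : 'rV[R]_d -> R) := foldr partial f s.

Definition smooth (f : 'rV[R]_d -> R) :=
  forall s, continuous (partials s f) /\
    forall i x, derivable (partials s f) x (delta_mx ord0 i).

Definition test_function : set ('rV[R]_d -> R) :=
  [set phi | smooth phi /\
    exists K, [/\ compact K, K `<=` Om & forall x, ~ K x -> phi x = 0]].

Definition multi_partial (a : 'I_d -> nat) :=
  partials (flatten [seq nseq (a i) i | i <- enum 'I_d]).

Definition weak_derivative p q (a : 'I_d -> nat) (f g : field p q) :=
  forall phi, test_function phi -> forall i j,
    \int[mu]_(x in Om) (f x i j * multi_partial a phi x) =
    (-1) ^+ (\sum_k a k)%N * \int[mu]_(x in Om) (g x i j * phi x).

(* H^r(Om): g lists the weak derivatives of f of order at most r.  They are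
   unique almost everywhere, so the infimum in Hnorm is over a single value if
   f is in H^r(Om), and is +oo otherwise. *)

Definition multi_index (r : nat) := {ffun 'I_d -> 'I_r.+1}.

Definition weak_jet p q (r : nat) (f : field p q)
    (g : multi_index r -> field p q) :=
  in_L2 f /\ forall a : multi_index r, (\sum_i a i <= r)%N ->
    in_L2 (g a) /\ weak_derivative (fun i => a i) f (g a).

Definition in_H p q (r : nat) : set (field p q) :=
  [set f : field p q | exists g, @weak_jet p q r f g].

Definition Hnorm p q (r : nat) (f : field p q) : \bar R :=
  ereal_inf [set (\sum_(a : multi_index r | (\sum_i a i <= r)%N)
                   L2norm (g a) ^+ 2) `^ 2^-1 | g in weak_jet f]%E.

(* H(div, Om, S).  An element is represented by a pair (tau, div tau) whose
   second component is the weak row-wise divergence of the first; it is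
   determined almost everywhere by tau. *)

Definition tensor_div := (field d d * field 1 d)%type.

Definition weak_divergence (tau : field d d) (g : field 1 d) :=
  forall phi, test_function phi -> forall i,
    \sum_j \int[mu]_(x in Om) (tau x i j * partial j phi x) =
    - \int[mu]_(x in Om) (g x ord0 i * phi x).

Definition in_Hdiv : set tensor_div :=
  [set tau | [/\ in_L2 tau.1, {ae mu, forall x, Om x -> (tau.1 x)^T = tau.1 x},
                 in_L2 tau.2 & weak_divergence tau.1 tau.2]].

Definition Hdivnorm (tau : tensor_div) : \bar R :=
  ((L2norm tau.1 ^+ 2 + L2norm tau.2 ^+ 2) `^ 2^-1)%E.

(* Cinv is the compliance tensor field, the pointwise inverse of C. *)

Definition form_a (Cinv : 'rV[R]_d -> tensor4 R d) (sigma tau : field d d) : R :=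
  \int[mu]_(x in Om) frob (tapp (Cinv x) (sigma x)) (tau x).

Definition form_b (v : field 1 d) (tau : tensor_div) : R :=
  \int[mu]_(x in Om) frob (v x) (tau.2 x).

Definition form_c (rho : 'rV[R]_d -> R) (v w : field 1 d) : R :=
  \int[mu]_(x in Om) (rho x * frob (v x) (w x)).

Definition L2inner (v w : field 1 d) : R :=
  \int[mu]_(x in Om) frob (v x) (w x).

Definition density (rho : 'rV[R]_d -> R) (rho0 rho1 : R) :=
  [/\ measurable_fun Om rho, 0 < rho0 &
      {ae mu, forall x, Om x -> rho0 <= rho x <= rho1}].

Definition elasticity_tensor (C Cinv : 'rV[R]_d -> tensor4 R d) (M0 M1 : R) :=
  [/\ forall i j k l, measurable_fun Om (fun x => C x i j k l),
      forall i j k l, measurable_fun Om (fun x => Cinv x i j k l),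
      0 < M0, 0 < M1 &
      {ae mu, forall x, Om x ->
        [/\ symmetric4 (C x), inverse4 (C x) (Cinv x) &
            forall t : 'M[R]_d, t^T = t ->
              M0 * frob t t <= frob (tapp (Cinv x) t) t <= M1 * frob t t]}].

End spaces.

Section functions_of_time.
Context (R : realType) (E : lmodType R).
(* X is a space of functions with seminorm N; elements u, v with N (u - v) = 0
   stand for the same element of the normed space. *)
Variables (X : set E) (N : E -> \bar R) (T : R).

Definition finite_dim_subspace (Y : set E) :=
  [/\ Y `<=` X, Y 0, forall (c : R) u v, Y u -> Y v -> Y (c *: u + v) &
      exists n (e : 'I_n -> E), (forall k, Y (e k)) /\
        forall u, Y u -> exists c : 'I_n -> R,
          N (u - \sum_k c k *: e k) = 0%E].

Definition continuous_in (u : R -> E) :=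
  (forall t, 0 <= t <= T -> X (u t)) /\
  forall t, 0 <= t <= T -> N (u s - u t) @[s --> within `[0, T]%classic (nbhs t)] --> 0%E.

(* One-sided derivatives at the end points. *)
Definition time_derivative (u du : R -> E) :=
  forall t, 0 <= t <= T -> X (du t) /\
    N ((s - t)^-1 *: (u s - u t) - du t) @[s --> within `[0, T]%classic t^'] --> 0%E.

Definition C1_in (u du : R -> E) :=
  [/\ continuous_in u, time_derivative u du & continuous_in du].

Definition simple_function (s : R -> E) :=
  exists n (A : 'I_n -> set R) (x : 'I_n -> E),
    (forall k, measurable (A k) /\ X (x k)) /\
    s = fun t => \sum_k (\1_(A k) t : R) *: x k.

Definition bochner_measurable (u : R -> E) :=
  exists s : nat -> R -> E, (forall n, simple_function (s n)) /\
    {ae @lebesgue_measure R, forall t, 0 <= t <= T ->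
      N (s n t - u t) @[n --> \oo] --> 0%E}.

Definition Lp_norm (p : \bar R) (u : R -> E) : \bar R :=
  'N[@lebesgue_measure R]_p [(fun t => N (u t)) \_ `[0%R, T]%classic]%E.

Definition in_Lp (p : \bar R) (u : R -> E) :=
  [/\ {ae @lebesgue_measure R, forall t, 0 <= t <= T -> X (u t)},
      bochner_measurable u & (Lp_norm p u < +oo)%E].

End functions_of_time.

Section problems.
Context (R : realType) (d : nat) (Om : set 'rV[R]_d) (T : R).
Variables (rho : 'rV[R]_d -> R) (Cinv : 'rV[R]_d -> tensor4 R d).
Variable (f : R -> field R d 1 d).

Let mu : {measure set 'rV[R]_d -> \bar R} := lebesgue_rV R d.
Let a := form_a Om Cinv.
Let b := @form_b R d Om.
Let c := form_c Om rho.

(* The evolution problem with test spaces H and V; it is the weak problem for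
   H = H(div, Om, S), V = L^2(Om)^d and the semi-discrete one for H = H_h,
   V = V_h. *)
Definition evolution_problem (H : set (tensor_div R d)) (V : set (field R d 1 d))
    (psi : tensor_div R d) (phi : field R d 1 d)
    (sigma dsigma : R -> tensor_div R d) (v dv : R -> field R d 1 d) :=
  [/\ forall t, 0 <= t <= T -> forall tau, H tau ->
        a (dsigma t).1 tau.1 + a (sigma t).1 tau.1 + b (v t) tau = 0,
      forall t, 0 <= t <= T -> forall w, V w ->
        c (dv t) w - b w (sigma t) = L2inner Om (f t) w,
      {ae mu, forall x, Om x -> v 0 x = phi x} &
      {ae mu, forall x, Om x -> (sigma 0).1 x = psi.1 x}].

Definition elliptic_projection (Hh : set (tensor_div R d))
    (Vh : set (field R d 1 d)) (sigma dsigma : R -> tensor_div R d)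
    (dv : R -> field R d 1 d)
    (sigmahat : R -> tensor_div R d) (vhat : R -> field R d 1 d) :=
  forall t, 0 <= t <= T ->
    [/\ Hh (sigmahat t), Vh (vhat t),
        forall tau, Hh tau ->
          a (sigmahat t).1 tau.1 + b (vhat t) tau = - a (dsigma t).1 tau.1 &
        forall w, Vh w ->
          b w (sigmahat t) = b w (sigma t) /\
          b w (sigma t) = c (dv t) w - L2inner Om (f t) w].

(* The real supremum of the empty set is 0. *)
Definition inf_sup (Hh : set (tensor_div R d)) (Vh : set (field R d 1 d))
    (C : R) :=
  forall w, Vh w ->
    (L2norm Om w <=
     (C * sup [set b w tau / fine (Hdivnorm Om tau) |
               tau in [set tau | Hh tau /\ Hdivnorm Om tau != 0%E]])%:E)%E.

End problems.

(* Main.v *)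
Require Import Defs.
From HB Require Import structures.
From mathcomp Require Import all_boot all_order all_algebra.
From mathcomp Require Import all_classical all_reals all_analysis.
From mathcomp Require Import measurable_realfun ess_sup_inf.
From mathcomp Require Import ring lra.

(** The error is split at the elliptic projection.  The difference
    sigma - sigmahat, v - vhat is bounded by assumption.  The difference
    e = (sigmahat - sigmah, vhat - vh) lies in the discrete spaces, so e itself can
    be used as test function in the difference of the semi-discrete problem and of
    the equations of the projection.  The terms with b cancel and, with
    B = a + c on pairs of a stress and a velocity, one obtains
    B (e_t, e) <= B (r, e), where r = (sigmahat_t - sigma_t, vhat_t - v_t)
    ([error_inequality]).  Integrating the derivative 2 B (e_t, e) of the energy
    B (e, e) in time gives
    max B (e, e) <= 2 B (e(0), e(0)) + 4 T int B (r, r)  ([energy_estimate]).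
    The first term is bounded by the error of the projection at time 0 and by the
    interpolation error of the initial data, the second by the approximation of
    the time derivatives.  The bounds on rho and on the compliance tensor make B
    equivalent to the L2 product ([form_a_bounds], [form_c_bounds]).

    Two points are delicate.  First, sigmahat and vhat are differentiable at every
    time, but nothing is known about the continuity or integrability of their
    derivatives, and B (r, r) is bounded at almost every time only.  The passage
    from the differential to the integral inequality therefore needs a theorem on
    functions that are differentiable everywhere ([le_integral_derivative]); for
    functions that are differentiable almost everywhere it fails.

    Second, the bound of B (r, r) involves the sum of the functions
    |sigma_t|_m and |v_t|_m' of time, and the integral of its square is estimated
    by two separate integrals.  This requires that the functions be measurable.
    They are so, up to a null set, because sigma_t and v_t are limits of simple
    functions and the norm satisfies the triangle inequality
    ([bochner_norm_measurable]).  For the Sobolev norm that inequality rests on the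
    additivity of the integrals that define weak derivatives ([HnormB]), hence on
    the measurability and boundedness of the derivatives of test functions.

    The time 0, at which the approximation property of the projection need not
    hold, is reached by continuity ([snorm_le_initial]). *)

Set Implicit Arguments.
Unset Strict Implicit.
Unset Printing Implicit Defensive.

Import Order.TTheory GRing.Theory Num.Theory.
Import numFieldNormedType.Exports.

Local Open Scope classical_set_scope.
Local Open Scope ring_scope.

(** * Semi-inner products *)

Section semi_inner.
Context (R : realType) (E : lmodType R).
Implicit Types (X : set E) (B : E -> E -> R).

Definition lin_subspace X := X 0 /\ forall (c : R) u v, X u -> X v -> X (c *: u + v).

(** Functions that agree almost everywhere are not identified, so the forms of
    the problem are symmetric, linear and nonnegative only on a subspace of all
    functions, and they may vanish at nonzero vectors. *)
Record semi_inner X B := SemiInner {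
  si_subspace : lin_subspace X;
  si_sym : forall u v, X u -> X v -> B u v = B v u;
  si_lin : forall c u v w, X u -> X v -> X w ->
    B (c *: u + v) w = c * B u w + B v w;
  si_ge0 : forall u, X u -> 0 <= B u u }.

Definition snorm B u : R := Num.sqrt (B u u).

Lemma subspaceZ X c u : lin_subspace X -> X u -> X (c *: u).
Proof. by move=> [X0 XL] Xu; rewrite -[_ *: _]addr0; exact: XL. Qed.

Lemma subspaceD X u v : lin_subspace X -> X u -> X v -> X (u + v).
Proof. by move=> [X0 XL] Xu Xv; rewrite -[u]scale1r; exact: XL. Qed.

Lemma subspaceN X u : lin_subspace X -> X u -> X (- u).
Proof. by move=> XS Xu; rewrite -scaleN1r; exact: subspaceZ. Qed.

Lemma subspaceB X u v : lin_subspace X -> X u -> X v -> X (u - v).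
Proof. by move=> XS Xu Xv; apply: subspaceD => //; exact: subspaceN. Qed.

Variables (X : set E) (B : E -> E -> R).
Hypothesis H : semi_inner X B.
Let XS := si_subspace H.

Lemma siDl u v w : X u -> X v -> X w -> B (u + v) w = B u w + B v w.
Proof. by move=> *; rewrite -[u in LHS]scale1r (si_lin H) // mul1r. Qed.

Lemma siZl c u w : X u -> X w -> B (c *: u) w = c * B u w.
Proof.
move=> Xu Xw; have X0 := XS.1.
have h : B 0 w = 0.
  by have := siDl X0 X0 Xw; rewrite addr0 => /esym/(canRL (addrK _)); rewrite subrr.
by rewrite -[_ *: _]addr0 (si_lin H) // h addr0.
Qed.

Lemma siBl u v w : X u -> X v -> X w -> B (u - v) w = B u w - B v w.
Proof.
move=> Xu Xv Xw; rewrite siDl //; last exact: subspaceN.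
by rewrite -scaleN1r siZl // mulN1r.
Qed.

Lemma siDr u v w : X u -> X v -> X w -> B w (u + v) = B w u + B w v.
Proof.
move=> Xu Xv Xw; rewrite (si_sym H) //; last exact: subspaceD.
by rewrite siDl // !(si_sym H Xw).
Qed.

Lemma siZr c u w : X u -> X w -> B w (c *: u) = c * B w u.
Proof.
move=> Xu Xw; rewrite (si_sym H) //; last exact: subspaceZ.
by rewrite siZl // !(si_sym H Xw).
Qed.

Lemma snorm_ge0 u : 0 <= snorm B u. Proof. exact: sqrtr_ge0. Qed.

Lemma snorm_sqr u : X u -> snorm B u ^+ 2 = B u u.
Proof. by move=> Xu; rewrite sqr_sqrtr // (si_ge0 H). Qed.

Lemma si_expand c u v : X u -> X v ->
  B (c *: u + v) (c *: u + v) = c ^+ 2 * B u u + c *+ 2 * B u v + B v v.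
Proof.
move=> Xu Xv; have Xcu := subspaceZ c XS Xu.
rewrite (si_lin H) //; last exact: subspaceD.
rewrite !siDr // !siZr // (si_sym H Xv Xu); ring.
Qed.

(** The quadratic polynomial c |-> B (c u + v) (c u + v) is nonnegative.  If
    B u u = 0 it is affine, hence constant; otherwise its value at its minimum
    gives the bound. *)
Lemma cauchy_schwarz u v : X u -> X v -> `|B u v| <= snorm B u * snorm B v.
Proof.
move=> Xu Xv; rewrite -sqrtrM ?(si_ge0 H) // -sqrtr_sqr ler_wsqrtr //.
have q c : 0 <= c ^+ 2 * B u u + c *+ 2 * B u v + B v v.
  by rewrite -si_expand //; apply: (si_ge0 H); exact: XS.2.
have := si_ge0 H Xu; rewrite le_eqVlt => /orP[/eqP u0|u0]; last first.
  have := q (- B u v / B u u).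
  have -> : (- B u v / B u u) ^+ 2 * B u u + (- B u v / B u u) *+ 2 * B u v + B v v
     = B v v - B u v ^+ 2 / B u u by field; rewrite gt_eqF.
  by rewrite subr_ge0 ler_pdivrMr // mulrC.
rewrite -u0 mul0r; case: (eqVneq (B u v) 0) => [->|n0]; first by rewrite expr0n.
have := q (- (B v v + 1) / (B u v *+ 2)); rewrite -u0 mulr0 add0r.
have -> : (- (B v v + 1) / (B u v *+ 2)) *+ 2 * B u v + B v v = - 1.
  by field; rewrite n0.
by rewrite oppr_ge0 ler10.
Qed.

Lemma snormZ c u : X u -> snorm B (c *: u) = `|c| * snorm B u.
Proof.
move=> Xu; have Xcu := subspaceZ c XS Xu.
by rewrite /snorm siZl // siZr // mulrA -expr2 sqrtrM ?sqr_ge0 // sqrtr_sqr.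
Qed.

Lemma snormN u : X u -> snorm B (- u) = snorm B u.
Proof. by move=> Xu; rewrite -scaleN1r snormZ // normrN1 mul1r. Qed.

Lemma snormD u v : X u -> X v -> snorm B (u + v) <= snorm B u + snorm B v.
Proof.
move=> Xu Xv; have Xuv := subspaceD XS Xu Xv.
rewrite -(@ler_pXn2r _ 2) ?nnegrE ?addr_ge0 ?snorm_ge0 //.
rewrite snorm_sqr // sqrrD !snorm_sqr // -[u in B (u + _)]scale1r.
rewrite -[u in X in B _ X]scale1r si_expand // expr1n mul1r.
rewrite lerD2r lerD2l mulr_natl lerMn2r /=.
exact: le_trans (ler_norm _) (cauchy_schwarz Xu Xv).
Qed.

Lemma snormB u v : X u -> X v -> snorm B (u - v) <= snorm B u + snorm B v.
Proof.
move=> Xu Xv; rewrite -(snormN Xv); apply: snormD => //; exact: subspaceN.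
Qed.

End semi_inner.

(** * Semi-inner products *)
(** * Integrating a pointwise bound on a derivative *)

(** The supremum of the times up to which P holds is reached because P passes to
    left limits, and it cannot be smaller than b because P extends to the right. *)
Lemma real_induction (R : realType) (a b : R) (P : R -> Prop) :
  a <= b -> P a ->
  (forall t, a < t <= b -> (forall s, a <= s < t -> P s) -> P t) ->
  (forall t, a <= t < b -> P t ->
     exists2 d, 0 < d & forall s, t < s < t + d -> s <= b -> P s) ->
  forall t, a <= t <= b -> P t.
Proof.
move=> ab Pa Pl Pr.
pose S := [set t | a <= t <= b /\ forall s, a <= s <= t -> P s].
have Sa : S a.
  by split; [rewrite lexx | move=> s /le_anti <-].
have hS : has_sup S by split; [exists a | exists b => t [] /andP[]].
have ac : a <= sup S by apply: (ub_le_sup hS.2).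
have cb : sup S <= b by apply: ge_sup; [exists a | move=> t [] /andP[]].
have below s : a <= s < sup S -> P s.
  move=> /andP[as_ sc]; have [t [_ St] st] := sup_gt (ex_intro _ a Sa) sc.
  by apply: St; rewrite as_ ltW.
have Pc : P (sup S).
  case: (eqVneq a (sup S)) => [<- //|anc].
  by apply: Pl below => //; rewrite lt_neqAle anc ac cb.
have Pcs s : a <= s <= sup S -> P s.
  move=> /andP[as_]; rewrite le_eqVlt => /orP[/eqP-> //|sc].
  by apply: below; rewrite as_.
case: (ltP (sup S) b) => [cb'|bc]; last first.
  by move=> t /andP[at_ tb]; apply: Pcs; rewrite at_ (le_trans tb).
have [|d d0 Pd] := Pr (sup S) _ Pc; first by rewrite ac.
pose t := Num.min (sup S + d / 2) b.
have ct : sup S < t by rewrite lt_min cb' ltrDl divr_gt0.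
have td : t < sup S + d.
  by rewrite gt_min ltrD2l ltr_pdivrMr // mulr_natr mulr2n ltrDl d0.
have tb : t <= b by rewrite ge_min lexx orbT.
have St : S t.
  split; first by rewrite tb (le_trans ac) // ltW.
  move=> s /andP[as_ st]; case: (leP s (sup S)) => [sc|cs].
    by apply: Pcs; rewrite as_.
  by apply: Pd; rewrite ?cs ?(le_lt_trans st) // (le_trans st).
by have := ub_le_sup hS.2 St; rewrite leNgt ct.
Qed.

Lemma lebesgue_measure_cc (R : realType) (a b : R) : a <= b ->
  @lebesgue_measure R `[a, b] = (b - a)%:E.
Proof.
move=> ab; rewrite lebesgue_measure_itv /= lte_fin; case: ltP => // ba.
by rewrite (@le_anti _ _ b a) ?ba // subrr.
Qed.

Lemma lebesgue_measure_cc_fin (R : realType) (a b : R) :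
  (@lebesgue_measure R `[a, b] < +oo)%E.
Proof.
by rewrite lebesgue_measure_itv /=; case: ifP => _; rewrite ?ltry // -EFinB ltry.
Qed.

(** If the right difference quotients of y at every t are asymptotically at most
    some finite D <= g t, then y increases by at most the integral of g.  The
    derivative of y may be discontinuous and far from integrable.  The bound has
    to hold at every time, but a null set of times can be absorbed in the value
    +oo of g.  The proof replaces g by a lower semicontinuous majorant of nearly
    the same integral, as in the Vitali-Caratheodory theorem: a sum of multiples
    of indicators of open sets V k that contain the level sets of g.  At each time
    t the majorant is at least D on a whole neighbourhood of t, so that its
    primitive U grows at least as fast as y just after t, up to a small slope. *)
Section derivative_bound.
Context (R : realType).
Local Notation mu := (@lebesgue_measure R).
Variables (a b : R) (y : R -> R) (g : R -> \bar R).
Hypothesis ab : a <= b.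
Hypothesis mg : measurable_fun `[a, b] g.
Hypothesis g0 : forall t, a <= t <= b -> (0 <= g t)%E.
Hypothesis ycont : forall t, a < t <= b -> forall e, 0 < e ->
  exists2 d, 0 < d & forall s, t - d < s < t -> a <= s -> y t <= y s + e.
Hypothesis yder : forall t, a <= t < b -> exists2 D, (D%:E <= g t)%E &
  forall e, 0 < e -> exists2 d, 0 < d &
    forall s, t < s < t + d -> s <= b -> y s - y t <= (D + e) * (s - t).

Section level_sets.
Variable eta : R.
Hypothesis eta0 : 0 < eta.
Hypothesis gfin : (\int[mu]_(t in `[a, b]) g t < +oo)%E.

Let lev k := `[a, b] `&` [set t | ((k%:R * eta)%:E < g t)%E].

Let mlev k : measurable (lev k).
Proof. exact: emeasurable_fun_o_infty. Qed.

Let levfin k : (mu (lev k) < +oo)%E.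
Proof.
apply: (@le_lt_trans _ _ (mu `[a, b])).
  by apply: le_measure; rewrite ?inE //; [exact: mlev|exact: subIsetl].
by rewrite lebesgue_measure_cc // ltry.
Qed.

(** At a time where n eta < g <= (n+1) eta, exactly n+1 levels contribute. *)
Let sum_lev n : (\sum_(k < n) eta%:E * mu (lev k) <=
  \int[mu]_(t in `[a, b]) g t + (eta * (b - a))%:E)%E.
Proof.
have -> : (\sum_(k < n) eta%:E * mu (lev k) =
  \int[mu]_(t in `[a, b]) \sum_(k < n) (eta * \1_(lev k) t)%:E)%E.
  rewrite ge0_integral_sum //; last 2 first.
  - move=> k; apply/measurable_EFinP; apply: measurable_funM => //.
    apply: measurable_indic; exact: mlev.
  - by move=> k t _; rewrite lee_fin mulr_ge0 // ltW.
  apply: eq_bigr => k _; under eq_integral do rewrite EFinM.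
  rewrite ge0_integralZl //; last 2 first.
  - by apply/measurable_EFinP; apply: measurable_indic; exact: mlev.
  - by rewrite lee_fin ltW.
  rewrite integral_indic //; last exact: mlev.
  by congr (_ * mu _)%E; apply/esym/setIidl; exact: subIsetl.
have -> : (eta * (b - a))%:E = (\int[mu]_(t in `[a, b]) (cst eta%:E t))%E.
  by rewrite integral_cst // EFinM; congr (_ * _)%E; rewrite -lebesgue_measure_cc.
rewrite -ge0_integralD //; last by move=> t _; rewrite lee_fin ltW.
apply: ge0_le_integral => //.
- by move=> t _; apply: sume_ge0 => k _; rewrite lee_fin mulr_ge0 // ltW.
- apply: emeasurable_sum => k; apply/measurable_EFinP; apply: measurable_funM => //.
  apply: measurable_indic; exact: mlev.
- by apply: emeasurable_funD.
move=> t tab; have gt0 : (0 <= g t)%E by apply: g0; move: tab; rewrite /= in_itv.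
elim: n => [|n IH]; first by rewrite big_ord0 adde_ge0 // lee_fin ltW.
rewrite big_ord_recr /=; have [tn|tn] := pselect (lev n t); last first.
  by rewrite indicE memNset // mulr0 adde0.
apply: (@le_trans _ _ (\sum_(k < n) eta%:E + eta%:E))%E.
  apply: leeD; last by rewrite indicE mem_set // mulr1.
  apply: lee_sum => k _; rewrite lee_fin ler_piMr ?(ltW eta0) // indicE.
rewrite leeD2r // sumEFin big_const_ord iter_addr_0 -mulr_natl ltW //.
by case: tn.
Qed.

Let cover : exists V : nat -> set R, forall k,
  [/\ open (V k), lev k `<=` V k & (mu (V k `&` `[a, b]) <= mu (lev k) + ((2^-1) ^+ k)%:E)%E].
Proof.
have h k : exists V, [/\ open V, lev k `<=` V &
    (mu (V `&` `[a, b]) <= mu (lev k) + ((2^-1) ^+ k)%:E)%E].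
  have [|V [oV sV mV]] := @lebesgue_regularity_outer R (lev k) ((2^-1) ^+ k) (mlev k) (levfin k).
    by rewrite exprn_gt0.
  exists V; split => //; have mVV := open_measurable oV; have mk := mlev k.
  apply: le_trans (leeD2l (mu (lev k)) (ltW mV)).
  apply: (@le_trans _ _ (mu (lev k `|` (V `\` lev k)))).
    apply: le_measure; rewrite ?inE.
    - exact: measurableI.
    - by apply: measurableU => //; exact: measurableD.
    - by move=> t [Vt _]; have [?|?] := pselect (lev k t); [left|right].
  by apply: measureU2 => //; exact: measurableD.
by have [V hV] := choice h; exists V.
Qed.

Lemma level_set_bound : y b - y a <=
  fine (\int[mu]_(t in `[a, b]) g t)%E + 2 * eta * (b - a + 1).
Proof.
have [V hV] := cover.
pose m k t := fine (mu (V k `&` `[a, t])).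
pose U_ n t := \sum_(k < n) eta * m k t.
have mV k t : measurable (V k `&` `[a, t]).
  by apply: measurableI => //; have [+ _ _] := hV k; exact: open_measurable.
have ffin k t : mu (V k `&` `[a, t]) \is a fin_num.
  rewrite ge0_fin_numE //; apply: (@le_lt_trans _ _ (mu `[a, t])).
    apply: le_measure; rewrite ?inE //.
exact: mV.
  exact: lebesgue_measure_cc_fin.
have m0 k t : 0 <= m k t by rewrite fine_ge0.
have mle k s t : s <= t -> m k s <= m k t.
  move=> st; apply: fine_le; rewrite ?ffin //; apply: le_measure; rewrite ?inE //.
  - exact: mV.
  - exact: mV.
  by apply: setIS => x /=; rewrite !in_itv /= => /andP[-> /le_trans]; exact.
have minc k s t : a <= s <= t -> (forall x, s <= x <= t -> V k x) ->
    m k s + (t - s) <= m k t.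
  move=> /andP[as_ st] stV; rewrite -lee_fin EFinD !fineK ?ffin //.
  have -> : (t - s)%:E = mu `]s, t].
    rewrite lebesgue_measure_itv /= lte_fin; case: ltP => [_|ts]; first by rewrite EFinB.
    by rewrite (@le_anti _ _ s t) ?st // subrr.
  rewrite -measureU //; first last.
  - rewrite -subset0 => x [[_ /=]]; rewrite !in_itv /= => /andP[_ xs] /andP[sx _].
    by move: (lt_le_trans sx xs); rewrite ltxx.
  - exact: mV.
  apply: le_measure; rewrite ?inE; [by apply: measurableU => //; exact: mV|exact: mV|].
  move=> x [[Vx /=]|/=]; rewrite !in_itv /= => /andP[h1 h2].
    by split => //; rewrite h1 (le_trans h2).
  split; first by apply: stV; rewrite h2 ltW.
  by rewrite h2 (le_trans as_) // ltW.
pose M := fine (\int[mu]_(t in `[a, b]) g t)%E + eta * (b - a) + 2 * eta.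
have Ub n t : t <= b -> U_ n t <= M.
  move=> tb; apply: (@le_trans _ _ (U_ n b)).
    by apply: ler_sum => k _; rewrite ler_pM2l // mle.
  have gf : (\int[mu]_(t in `[a, b]) g t)%E \is a fin_num.
    rewrite ge0_fin_numE //; apply: integral_ge0 => x; rewrite /= in_itv; exact: g0.
  have geo : \sum_(k < n) (2^-1 : R) ^+ k <= 2.
    suff -> : \sum_(k < n) (2^-1 : R) ^+ k = 2 - 2 * 2^-1 ^+ n.
      by rewrite gerBl mulr_ge0 // exprn_ge0.
    elim: n => [|n IH]; first by rewrite big_ord0 expr0 mulr1 subrr.
    by rewrite big_ord_recr /= IH exprS; field.
  rewrite -lee_fin /U_ -sumEFin.
  apply: (@le_trans _ _ (\sum_(k < n) eta%:E * mu (lev k) + \sum_(k < n) (eta * 2^-1 ^+ k)%:E)%E).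
    rewrite -big_split /=; apply: lee_sum => k _.
    rewrite EFinM fineK ?ffin // EFinM -ge0_muleDr //.
    by rewrite lee_pmul2l //; have [] := hV k.
  rewrite /M !EFinD fineK //; apply: leeD; first exact: sum_lev.
  by rewrite sumEFin lee_fin -mulr_sumr mulrC ler_pM2r.
(* U_ n t is the integral up to t of the first n terms of the majorant; the
   supremum keeps its primitive real valued. *)
pose U t := sup (range (fun n => U_ n t)).
have hU t : t <= b -> has_sup (range (fun n => U_ n t)).
  by move=> tb; split; [exists (U_ 0%N t), 0%N | exists M => _ [n _ <-]; exact: Ub].
have U_U n t : t <= b -> U_ n t <= U t.
  by move=> tb; apply: (ub_le_sup (hU _ tb).2); exists n.
have U0 t : t <= b -> 0 <= U t.
  by move=> tb; rewrite (le_trans _ (U_U 0%N _ tb)) // /U_ big_ord0.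
have UM t : t <= b -> U t <= M.
  by move=> tb; apply: ge_sup; [exact: (hU _ tb).1 | move=> _ [n _ <-]; exact: Ub].
have Uinc n s t : a <= s <= t -> t <= b ->
    (forall k, (k < n)%N -> forall x, s <= x <= t -> V k x) ->
    U s + n%:R * eta * (t - s) <= U t.
  move=> /andP[as_ st] tb hn; rewrite -lerBrDr.
  apply: ge_sup; first by apply: (hU _ _).1; exact: le_trans tb.
  move=> _ [p _ <-]; rewrite lerBrDr.
  apply: le_trans (U_U (n + p)%N t tb).
  have -> : U_ p s + n%:R * eta * (t - s) = U_ p s + \sum_(k < n) eta * (t - s).
    by rewrite sumr_const card_ord -[in RHS]mulr_natl mulrA.
  apply: (@le_trans _ _ (U_ (n + p)%N s + \sum_(k < n) eta * (t - s))).
    rewrite lerD2r /U_ addnC big_split_ord /= lerDl.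
    by apply: sumr_ge0 => k _; rewrite mulr_ge0 // ltW.
  rewrite /U_ !big_split_ord /= addrAC -big_split /=.
  apply: lerD; apply: ler_sum => k _; last by rewrite ler_pM2l // mle.
  rewrite -mulrDr ler_pM2l //; apply: minc; first by rewrite as_.
  exact: hn.
have key : forall t, a <= t <= b -> y t <= y a + U t + eta * (t - a).
  apply: real_induction ab _ _ _.
  - by rewrite subrr mulr0 addr0 lerDl U0.
  - move=> t /andP[at_ tb] IH; apply/ler_addgt0Pr => e e0.
    have [|d d0 yd] := ycont _ e0 (t := t); first by rewrite at_.
    pose s := Num.max a (t - d / 2).
    have st : s < t by rewrite gt_max at_ gtrBl divr_gt0.
    have as_ : a <= s by rewrite le_max lexx.
    have ds : t - d < s.
      by rewrite lt_max ltrD2l ltrN2 ltr_pdivrMr // mulr_natr mulr2n ltrDl d0 orbT.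
    have := yd s; rewrite ds st => /(_ isT as_) ys.
    apply: (le_trans ys); rewrite lerD2r; apply: le_trans (IH s _) _.
      by rewrite as_.
    apply: lerD; last by rewrite ler_pM2l // lerD2r ltW.
    rewrite lerD2l; have := @Uinc 0%N s t; rewrite !mul0r addr0; apply => //.
    by rewrite as_ ltW.
  - move=> t /andP[at_ tb] IH.
    have [|D Dg /(_ _ eta0)[d d0 yd]] := yder (t := t); first by rewrite at_.
    (* n is the least number of levels that dominates the derivative D: the
       levels below n then all contain t, since D <= g t. *)
    have [n Dn nD] : exists2 n : nat, D <= n%:R * eta & forall k, (k < n)%N -> k%:R * eta < D.
      have ex : exists n : nat, D <= n%:R * eta.
        exists (Num.truncn (`|D| / eta)).+1; rewrite -ler_pdivrMr // ltW //.
        rewrite (le_lt_trans _ (truncnS_gt _)) //.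
        by rewrite ler_pM2r ?invr_gt0 // ler_norm.
      exists (ex_minn ex); first by case: ex_minnP.
      case: ex_minnP => n _ nmin k kn; rewrite ltNge; apply/negP => /nmin.
      by rewrite leqNgt kn.
    have [d' d'0 Vd] : exists2 d', 0 < d' &
        forall k, (k < n)%N -> forall x, t <= x < t + d' -> V k x.
      have : \forall x \near t, forall k : 'I_n, V k x.
        apply: (@filter_forall R 'I_n (fun k x => V k x) (nbhs t) _) => k; have [oV sV _] := hV k.
        apply: open_nbhs_nbhs; split => //; apply: sV; split => /=.
          by rewrite in_itv /= at_ ltW.
        by rewrite (lt_le_trans _ Dg) // lte_fin nD.
      move=> /nbhs_ballP[d' d'0 Bd]; exists d' => // k kn x /andP[tx xd].
      by apply: (Bd x _ (Ordinal kn)); rewrite /ball /= distrC ger0_norm ?subr_ge0 // ltrBlDl.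
    exists (Num.min d d'); first by rewrite lt_min d0.
    move=> s /andP[ts sd] sb.
    have sd1 : s < t + d by rewrite (lt_le_trans sd) // lerD2l ge_min lexx.
    have sd2 : s < t + d' by rewrite (lt_le_trans sd) // lerD2l ge_min lexx orbT.
    have := yd s; rewrite ts sd1 => /(_ isT sb).
    have := Uinc n t s; rewrite at_ (ltW ts) => /(_ isT sb) Ui.
    have {}Ui : U t + n%:R * eta * (s - t) <= U s.
      apply: Ui => k kn x /andP[tx xs]; apply: (Vd k kn).
      by rewrite tx (le_lt_trans xs).
    have : (D + eta) * (s - t) <= (n%:R * eta + eta) * (s - t).
      by rewrite ler_wpM2r ?subr_ge0 ?(ltW ts) // lerD2r.
    by move: IH Ui; rewrite !mulrDl; move: (n%:R * eta) => ne; nra.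
have := key b; rewrite ab lexx => /(_ isT).
have := UM b (lexx b); rewrite /M; nra.
Qed.

End level_sets.

(** The bounds at levels of width eta differ from the integral by a multiple of
    eta. *)
Lemma le_integral_derivative :
  ((y b - y a)%:E <= \int[mu]_(t in `[a, b]) g t)%E.
Proof.
have [->|gfin] := eqVneq (\int[mu]_(t in `[a, b]) g t)%E +oo%E; first exact: leey.
have {}gfin : (\int[mu]_(t in `[a, b]) g t < +oo)%E by rewrite ltey.
have gf : (\int[mu]_(t in `[a, b]) g t)%E \is a fin_num.
  rewrite ge0_fin_numE //; apply: integral_ge0 => x; rewrite /= in_itv; exact: g0.
rewrite -(fineK gf) lee_fin; apply/ler_addgt0Pr => e e0.
have c0 : 0 < 2 * (b - a + 1) by have := ab; lra.
have := level_set_bound (divr_gt0 e0 c0) gfin.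
by congr (_ <= _ + _); field; rewrite gt_eqF //; have := ab; lra.
Qed.

End derivative_bound.

(** * Semi-inner products *)
(** * The energy estimate *)

Section energy.
Context (R : realType) (E : lmodType R) (X : set E) (B : E -> E -> R) (T : R).
Hypothesis H : semi_inner X B.
Let XS := si_subspace H.

(** The form with the increment on the right also covers s = t, and it makes sense
    for a seminorm with real values. *)
Definition has_time_derivative (N : E -> R) (u du : R -> E) :=
  forall t, 0 <= t <= T -> forall e, 0 < e -> exists2 d, 0 < d &
    forall s, 0 <= s <= T -> `|s - t| < d ->
      N (u s - u t - (s - t) *: du t) <= e * `|s - t|.

(** B (u s) (u s) is expanded around u t, with u s - u t = (s - t) du t + w and w
    small; the terms of second order are absorbed by shrinking d. *)
Lemma sqr_snorm_time_derivative (u du : R -> E) :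
  (forall t, 0 <= t <= T -> X (u t)) -> (forall t, 0 <= t <= T -> X (du t)) ->
  has_time_derivative (snorm B) u du ->
  forall t, 0 <= t <= T -> forall e, 0 < e -> exists2 d, 0 < d &
    forall s, 0 <= s <= T -> `|s - t| < d ->
      `|B (u s) (u s) - B (u t) (u t) - (s - t) * (2 * B (du t) (u t))|
        <= e * `|s - t|.
Proof.
move=> Xu Xdu hd t tT e e0.
have Xt := Xu _ tT; have Xdt := Xdu _ tT.
pose q := 2 * (snorm B (u t) + snorm B (du t)).
pose c := B (du t) (du t).
have q0 : 0 <= q by rewrite mulr_ge0 // addr_ge0 // snorm_ge0.
have c0 : 0 <= c by exact: (si_ge0 H).
pose ep := Num.min 1 (e / (2 * (q + 1))).
have ep0 : 0 < ep by rewrite lt_min ltr01 divr_gt0 // mulr_gt0 // ltr_wpDl.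
have ep1 : ep <= 1 by rewrite ge_min lexx.
have epq : ep * (q + 1) <= e / 2.
  have : ep <= e / (2 * (q + 1)) by rewrite ge_min lexx orbT.
  rewrite ler_pdivlMr ?mulr_gt0 // ?ltr_wpDl //; lra.
have [d d0 hd1] := hd t tT ep ep0.
pose d' := Num.min d (Num.min 1 (e / (2 * (c + 1)))).
have d'0 : 0 < d' by rewrite !lt_min d0 ltr01 divr_gt0 // mulr_gt0 // ltr_wpDl.
have d'd : d' <= d by rewrite ge_min lexx.
have d'1 : d' <= 1 by rewrite !ge_min lexx orbT.
have d'c : d' * (c + 1) <= e / 2.
  have : d' <= e / (2 * (c + 1)) by rewrite !ge_min lexx !orbT.
  rewrite ler_pdivlMr ?mulr_gt0 // ?ltr_wpDl //; lra.
exists d' => // s sT std.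
have Xs := Xu _ sT.
pose h := s - t; rewrite -/h in std *.
pose w := u s - u t - h *: du t.
have hw : snorm B w <= ep * `|h| by apply: hd1 => //; exact: lt_le_trans d'd.
have Xhd := subspaceZ h XS Xdt.
have Xw : X w by apply: subspaceB XS _ Xhd; exact: subspaceB.
pose p := h *: du t + u t.
have Xp : X p by exact: subspaceD.
have -> : u s = 1 *: w + p.
  by rewrite scale1r /w /p addrA subrK subrK.
have -> : B (1 *: w + p) (1 *: w + p) - B (u t) (u t) - h * (2 * B (du t) (u t)) =
    B w w + 2 * B w p + h ^+ 2 * c.
  by rewrite (si_expand H) // {3 4}/p (si_expand H) // -/c; ring.
have h1 : `|h| <= 1 by rewrite (le_trans (ltW std)).
have h0 := normr_ge0 h.
have Bww : B w w <= ep * `|h| * (ep * `|h|).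
  by rewrite -(snorm_sqr H) // expr2 ler_pM ?snorm_ge0.
have np : 2 * snorm B p <= q.
  rewrite ler_pM2l // addrC; apply: (le_trans (snormD H Xhd Xt)).
  rewrite lerD2r (snormZ H) // ler_piMl ?snorm_ge0 //.
have Bwp : `|2 * B w p| <= ep * `|h| * q.
  rewrite normrM ger0_norm //.
  apply: (@le_trans _ _ (snorm B w * (2 * snorm B p))).
    by rewrite mulrCA ler_pM2l // (cauchy_schwarz H).
  by apply: ler_pM => //; rewrite ?mulr_ge0 ?snorm_ge0.
have hc : `|h ^+ 2 * c| <= `|h| * (d' * c).
  rewrite normrM normrX (ger0_norm c0) expr2 -mulrA ler_wpM2l //.
  by rewrite ler_wpM2r // ltW.
apply: le_trans (ler_normD _ _) _; apply: le_trans (lerD (ler_normD _ _) hc) _.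
rewrite (ger0_norm (si_ge0 H Xw)).
apply: le_trans (lerD (lerD Bww Bwp) (lexx _)) _.
have : ep * `|h| * (ep * `|h|) <= `|h| * d'.
  rewrite -mulrA mulrCA ler_wpM2l // mulrA.
  apply: le_trans (ltW std); by rewrite ler_piMl // -expr2 expr_le1 // ltW.
have : `|h| * (ep * q) <= `|h| * (ep * (q + 1)).
  by rewrite ler_wpM2l // ler_pM2l // lerDl.
have : `|h| * (ep * (q + 1)) <= `|h| * (e / 2) by rewrite ler_wpM2l.
have : `|h| * (d' * (c + 1)) <= `|h| * (e / 2) by rewrite ler_wpM2l.
move: (`|h|) => z; nra.
Qed.

Hypothesis T0 : 0 < T.

Variables (u du r : R -> E) (g : R -> \bar R).
Hypothesis Xu : forall t, 0 <= t <= T -> X (u t).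
Hypothesis Xdu : forall t, 0 <= t <= T -> X (du t).
Hypothesis Xr : forall t, 0 <= t <= T -> X (r t).
Hypothesis hd : has_time_derivative (snorm B) u du.
Hypothesis hr : forall t, 0 <= t <= T -> B (du t) (u t) <= B (r t) (u t).
Hypothesis mg : measurable_fun `[0, T] g.
Hypothesis g0 : forall t, (0 <= g t)%E.
Hypothesis rg : {ae @lebesgue_measure R, forall t, 0 <= t <= T ->
  ((B (r t) (r t))%:E <= g t)%E}.
Let En t := B (u t) (u t).

Let En_cont t : 0 <= t <= T -> forall e, 0 < e -> exists2 d, 0 < d &
  forall s, 0 <= s <= T -> `|s - t| < d -> `|En s - En t| <= e.
Proof.
move=> tT e e0.
have [d d0 hd1] := sqr_snorm_time_derivative Xu Xdu hd tT ltr01.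
pose K := `|2 * B (du t) (u t)| + 1.
have K0 : 0 < K by rewrite ltr_wpDl.
exists (Num.min d (e / K)); first by rewrite lt_min d0 divr_gt0.
move=> s sT; rewrite lt_min => /andP[sd se].
have := hd1 s sT sd; rewrite -/(En s) -/(En t) mul1r => h1.
have -> : En s - En t = (En s - En t - (s - t) * (2 * B (du t) (u t))) +
  (s - t) * (2 * B (du t) (u t)) by rewrite subrK.
apply: le_trans (ler_normD _ _) _; apply: le_trans (lerD h1 (lexx _)) _.
rewrite normrM; move: se; rewrite ltr_pdivlMr // /K; lra.
Qed.

Let En_max : exists2 c, 0 <= c <= T & forall t, 0 <= t <= T -> En t <= En c.
Proof.
have [|c cT hc] := @EVT_max R En 0 T (ltW T0).
  apply/subspace_continuousP => t; rewrite /= in_itv /= => tT.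
  apply/cvgrPdist_le => e e0.
  have [d d0 hd1] := En_cont tT e0.
  apply/nbhs_ballP; exists d => // s; rewrite /ball /= in_itv /= => sd sT.
  by rewrite distrC; apply: hd1 => //; rewrite distrC.
exists c; first by move: cT; rewrite in_itv.
by move=> t tT; apply: hc; rewrite in_itv.
Qed.

(** The derivative of the energy En is at most 2 B (r s) (u s), and
    2 B r u <= 2 T B r r + B u u / (2 T).  Integrating up to the time c where En is
    maximal bounds En c by En 0 + 2 T int g + En c / 2, and the last term is
    absorbed on the left. *)
Lemma energy_estimate t : 0 <= t <= T ->
  ((B (u t) (u t))%:E <= (2 * B (u 0) (u 0))%:E +
     (4 * T)%:E * \int[@lebesgue_measure R]_(s in `[0%R, T]) g s)%E.
Proof.
move=> tT; have [c /andP[c0 cT] hc] := En_max.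
have z0T : 0 <= (0 : R) <= T by rewrite lexx ltW.
have Ec0 : 0 <= En c by apply: (si_ge0 H); apply: Xu; rewrite c0.
apply: (@le_trans _ _ (En c)%:E); first by rewrite lee_fin hc.
have [N [mN N0 rgN]] := rg.
pose k := (fun s => (2 * T)%:E * g s + (En c / (2 * T))%:E)%E.
(* On the null set N, where r is not controlled by g, the majorant is +oo. *)
pose g' := (fun s => k s + +oo * (\1_N s)%:E)%E.
have k0 s : (0 <= k s)%E.
  rewrite adde_ge0 // ?mule_ge0 // ?lee_fin ?mulr_ge0 ?(ltW T0) //.
  by rewrite invr_ge0 mulr_ge0 // ltW.
have g'0 s : (0 <= g' s)%E by rewrite adde_ge0 // mule_ge0 // lee_fin.
have mgc : measurable_fun `[0, c] g.
  by apply: measurable_funS mg => //; apply: subset_itvl; rewrite bnd_simp.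
have mk : measurable_fun `[0, c] k.
  by apply: emeasurable_funD => //; apply: measurable_funeM.
have mg' : measurable_fun `[0, c] g'.
  apply: emeasurable_funD => //; apply: measurable_funeM.
  by apply/measurable_EFinP; exact: measurable_indic.
have : ((En c - En 0)%:E <= \int[@lebesgue_measure R]_(s in `[0%R, c]) g' s)%E.
  apply: le_integral_derivative => //.
  - move=> s /andP[s0 sc] e e0.
    have sT : 0 <= s <= T by rewrite ltW //= (le_trans sc).
    have [d d0 hd1] := En_cont sT e0; exists d => // x /andP[dx xs] x0.
    rewrite -lerBlDl; apply: le_trans (ler_norm _) _; rewrite distrC.
    apply: hd1; first by rewrite x0 /= (le_trans (ltW xs)) // (le_trans sc).
    by rewrite distrC gtr0_norm ?subr_gt0 // ltrBlDr -ltrBlDl.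
  - move=> s /andP[s0 sc].
    have sT : 0 <= s <= T by rewrite s0 (le_trans (ltW sc)).
    exists (2 * B (du s) (u s)).
      have [Ns|Ns] := pselect (N s).
        rewrite /g' indicE mem_set //= mule1 addey ?leey //.
        by apply/eqP => kN; have := k0 s; rewrite kN.
      rewrite /g' indicE memNset //= mule0 adde0 /k.
      have rs : ((B (r s) (r s))%:E <= g s)%E.
        by apply: contrapT => nrs; apply: Ns; apply: rgN => /(_ sT).
      apply: (@le_trans _ _ ((2 * T)%:E * (B (r s) (r s))%:E + (En c / (2 * T))%:E)%E); last first.
        by rewrite leeD2r // lee_pmul2l // lte_fin mulr_gt0.
      rewrite -EFinM -EFinD lee_fin.
      have Xrs := Xr sT; have Xus := Xu sT.
      apply: (@le_trans _ _ (2 * B (r s) (u s))); first by rewrite ler_pM2l // hr.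
      have h1 : B (r s) (u s) <= snorm B (r s) * snorm B (u s).
        exact: le_trans (ler_norm _) (cauchy_schwarz H _ _).
      have h2 := hc _ sT; rewrite {1}/En -(snorm_sqr H) // in h2.
      rewrite -(snorm_sqr H Xrs).
      apply: (@le_trans _ _ (2 * T * snorm B (r s) ^+ 2 + snorm B (u s) ^+ 2 / (2 * T))).
        have : 0 <= (2 * T * snorm B (r s) - snorm B (u s)) ^+ 2 / (2 * T).
          by rewrite mulr_ge0 ?sqr_ge0 // invr_ge0 mulr_ge0 // ltW.
        have -> : (2 * T * snorm B (r s) - snorm B (u s)) ^+ 2 / (2 * T) =
          2 * T * snorm B (r s) ^+ 2 + snorm B (u s) ^+ 2 / (2 * T) -
          2 * (snorm B (r s) * snorm B (u s)) by field; rewrite gt_eqF.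
        lra.
      by rewrite lerD2l ler_pM2r // invr_gt0 mulr_gt0.
    move=> e e0; have [d d0 hd1] := sqr_snorm_time_derivative Xu Xdu hd sT e0.
    exists d => // x /andP[sx xd] xc.
    have := hd1 x _ _; rewrite gtr0_norm ?subr_gt0 // ltrBlDl => h.
    have {}h := h _ xd.
    have {h} := h (_ : 0 <= x <= T).
    rewrite (le_trans s0 (ltW sx)) (le_trans xc cT) => /(_ isT) h.
    have := le_trans (ler_norm _) h; rewrite /En; lra.
have -> : (\int[@lebesgue_measure R]_(s in `[0%R, c]) g' s =
  \int[@lebesgue_measure R]_(s in `[0%R, c]) k s)%E.
  apply: ge0_ae_eq_integral => //.
  exists N; split => // s; apply: contra_notP => Ns _.
  by rewrite /g' indicE memNset //= mule0 adde0.
rewrite /k ge0_integralD //; last 3 first.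
- by move=> s _; rewrite mule_ge0 // lee_fin mulr_ge0 // ltW.
- by apply: measurable_funeM.
- by move=> s _; rewrite lee_fin divr_ge0 // mulr_ge0 // ltW.
rewrite ge0_integralZl //; last by rewrite lee_fin mulr_ge0 // ltW.
have -> : (\int[@lebesgue_measure R]_(s in `[0%R, c]) (En c / (2 * T))%:E =
    (En c / (2 * T) * c)%:E)%E.
  rewrite (integral_cst _ _ (En c / (2 * T))%:E) // [RHS]EFinM; congr (_ * _)%E.
  by have := lebesgue_measure_cc c0; rewrite subr0.
pose J := (\int[@lebesgue_measure R]_(s in `[0%R, c]) g s)%E.
pose G := (\int[@lebesgue_measure R]_(s in `[0%R, T]) g s)%E.
move=> h'; have {h'} : ((En c - En 0)%:E <= (2 * T)%:E * J + (En c / (2 * T) * c)%:E)%E.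
  exact: h'.
rewrite -/G.
have J0 : (0 <= J)%E by exact: integral_ge0.
have JG : (J <= G)%E.
  apply: ge0_subset_integral => //; apply: subset_itvl; by rewrite bnd_simp.
have [Gy|Gy] := eqVneq G +oo%E.
  move=> _; rewrite Gy gt0_muley ?lte_fin ?mulr_gt0 // addey ?leey //.
have Gf : G \is a fin_num by rewrite ge0_fin_numE ?(le_trans J0) // ltey.
have Jf : J \is a fin_num by rewrite ge0_fin_numE // (le_lt_trans JG) // ltey.
rewrite -(fineK Jf) -(fineK Gf) in JG *.
rewrite -!EFinM -!EFinD !lee_fin in JG * => h.
have Ecc : En c / (2 * T) * c <= En c / 2.
  have -> : En c / (2 * T) * c = En c / 2 * (c / T) by field; rewrite gt_eqF.
  by rewrite ler_piMr ?divr_ge0 // ler_pdivrMr // mul1r.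
have : T * fine J <= T * fine G by rewrite ler_pM2l.
move: h Ecc; rewrite -/(En 0); move: (En c / (2 * T) * c) => z; lra.
Qed.

End energy.

(** * Semi-inner products *)
(** * Integrals of functions bounded almost everywhere *)

Section ae_integral.
Context d (T : measurableType d) (R : realType) (mu : {measure set T -> \bar R}).
Variables (D : set T) (mD : measurable D).
Implicit Types f g : T -> R.

Lemma ae_le_integrable f g : measurable_fun D f ->
  {ae mu, forall x, D x -> `|f x| <= g x} ->
  mu.-integrable D (EFin \o g) -> mu.-integrable D (EFin \o f).
Proof.
move=> mf fg ig; apply/integrableP; split; first exact/measurable_EFinP.
have /integrableP[mg] := ig; apply: le_lt_trans.
apply: ae_ge0_le_integral => //.
- by apply: measurableT_comp => //; exact/measurable_EFinP.
- by apply: measurableT_comp.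
apply: filterS fg => x /[swap] Dx /(_ Dx) fg /=.
by rewrite lee_fin (le_trans fg) // ler_norm.
Qed.

Lemma ae_eq_Rintegral f g : mu.-integrable D (EFin \o f) ->
  mu.-integrable D (EFin \o g) -> {ae mu, forall x, D x -> f x = g x} ->
  \int[mu]_(x in D) f x = \int[mu]_(x in D) g x.
Proof.
move=> /integrableP[mf _] /integrableP[mg _] fg; congr fine.
by apply: ae_eq_integral => //; apply: filterS fg => x /[swap] Dx /(_ Dx) /= ->.
Qed.

Lemma ae_ge0_Rintegral f : mu.-integrable D (EFin \o f) ->
  {ae mu, forall x, D x -> 0 <= f x} -> 0 <= \int[mu]_(x in D) f x.
Proof.
move=> fi f0; rewrite (@ae_eq_Rintegral _ (fun x => `|f x|)) //.
- by apply: Rintegral_ge0.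
- rewrite (_ : _ \o _ = abse \o (EFin \o f)) //; exact: integrable_abse.
by apply: filterS f0 => x /[swap] Dx /(_ Dx) /ger0_norm.
Qed.

Lemma ae_le_Rintegral f g : mu.-integrable D (EFin \o f) ->
  mu.-integrable D (EFin \o g) -> {ae mu, forall x, D x -> f x <= g x} ->
  \int[mu]_(x in D) f x <= \int[mu]_(x in D) g x.
Proof.
move=> fi gi fg; rewrite -subr_ge0 -RintegralB //; apply: ae_ge0_Rintegral.
  rewrite (_ : _ \o _ = (EFin \o g) \- (EFin \o f))%E //; exact: integrableB.
by apply: filterS fg => x /[swap] Dx /(_ Dx); rewrite subr_ge0.
Qed.

Lemma integrable_scaleR (c : R) f : mu.-integrable D (EFin \o f) ->
  mu.-integrable D (EFin \o (fun x => c * f x)).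
Proof. by move=> fi; have := integrableZl mD c fi. Qed.

Lemma integrable_linR (c : R) f g : mu.-integrable D (EFin \o f) ->
  mu.-integrable D (EFin \o g) ->
  mu.-integrable D (EFin \o (fun x => c * f x + g x)).
Proof.
move=> fi gi; rewrite (_ : _ \o _ = ((EFin \o (fun x => (c * f x)%R)) \+ (EFin \o g))%E) //.
by apply: integrableD => //; exact: integrable_scaleR.
Qed.

Lemma Rintegral_lin (c : R) f g : mu.-integrable D (EFin \o f) ->
  mu.-integrable D (EFin \o g) ->
  \int[mu]_(x in D) (c * f x + g x) =
  c * \int[mu]_(x in D) f x + \int[mu]_(x in D) g x.
Proof.
by move=> fi gi; rewrite RintegralD ?RintegralZl //; exact: integrable_scaleR.
Qed.

End ae_integral.

(** * The Frobenius product *)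

Section frobenius.
Context (R : realType) (p q : nat).
Implicit Types A B : 'M[R]_(p, q).

Lemma frobC A B : frob A B = frob B A.
Proof. by apply: eq_bigr => i _; apply: eq_bigr => j _; rewrite mulrC. Qed.

Lemma frob_linl c A B D : frob (c *: A + B) D = c * frob A D + frob B D.
Proof.
rewrite /frob mulr_sumr -big_split; apply: eq_bigr => i _ /=.
rewrite mulr_sumr -big_split; apply: eq_bigr => j _ /=.
by rewrite !mxE mulrDl mulrA.
Qed.

Lemma frob_ge0 A : 0 <= frob A A.
Proof. by apply: sumr_ge0 => i _; apply: sumr_ge0 => j _; rewrite -expr2 sqr_ge0. Qed.

Lemma sqr_le_frob A i j : A i j ^+ 2 <= frob A A.
Proof.
rewrite /frob (bigD1 i) //= (bigD1 j) //= -expr2 -addrA lerDl.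
apply: addr_ge0; first by apply: sumr_ge0 => k _; rewrite -expr2 sqr_ge0.
by apply: sumr_ge0 => k _; apply: sumr_ge0 => m _; rewrite -expr2 sqr_ge0.
Qed.

Lemma frob_le A B : `|frob A B| <= frob A A + frob B B.
Proof.
apply: le_trans (ler_norm_sum _ _ _) _; rewrite /frob -big_split.
apply: ler_sum => i _; apply: le_trans (ler_norm_sum _ _ _) _; rewrite -big_split.
apply: ler_sum => j _ /=; rewrite ler_norml.
have := sqr_ge0 (A i j - B i j); have := sqr_ge0 (A i j + B i j).
have := sqr_ge0 (A i j); have := sqr_ge0 (B i j); nra.
Qed.

End frobenius.

(** * The space L2 as a semi-inner product space *)

Lemma measurable_convex_polyhedral (R : realType) (d : nat) (Om : set 'rV[R]_d) :
  convex_polyhedral_domain Om -> measurable Om.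
Proof.
move=> [_ _ [n [A [b ->]]]].
rewrite (_ : mkset _ = \bigcap_(i in [set: 'I_n]) [set x | frob (A i) x < b i]).
  apply: fin_bigcap_measurable => // i _.
  have mA : measurable_fun setT (fun x : 'rV[R]_d => frob (A i) x).
    apply: measurable_sum => k; apply: measurable_sum => j.
    by apply: measurable_funM => //; rewrite (ord1 k); exact: measurable_coor.
  have := measurable_fun_ltr mA (measurable_cst (b i)).
  by move=> /(_ measurableT [set true] (Logic.I)); rewrite setTI.
by apply/seteqP; split => x; [move=> h i _; exact: h|move=> h i; exact: (h i Logic.I)].
Qed.

Section L2.
Context (R : realType) (d : nat) (Om : set 'rV[R]_d).
Hypothesis mOm : measurable Om.
Let mu : {measure set 'rV[R]_d -> \bar R} := lebesgue_rV R d.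

Definition L2ip p q (f g : field R d p q) : R := \int[mu]_(x in Om) frob (f x) (g x).

Lemma L2normE p q (f : field R d p q) :
  L2norm Om f = ((\int[mu]_(x in Om) (frob (f x) (f x))%:E) `^ 2^-1)%E.
Proof.
rewrite /L2norm unlock; congr (_ `^ _)%E; rewrite [RHS]integral_mkcond.
apply: eq_integral => x _; rewrite /patch; case: ifP => _ /=.
  by rewrite ger0_norm ?sqrtr_ge0 // powR_mulrn ?sqrtr_ge0 // sqr_sqrtr ?frob_ge0.
by rewrite normr0 powR0.
Qed.

Lemma L2norm_ge0 p q (f : field R d p q) : (0 <= L2norm Om f)%E.
Proof. exact: Lnorm_ge0. Qed.

Lemma measurable_frob p q (f g : field R d p q) :
  (forall i j, measurable_fun Om (fun x => f x i j)) ->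
  (forall i j, measurable_fun Om (fun x => g x i j)) ->
  measurable_fun Om (fun x => frob (f x) (g x)).
Proof.
move=> mf mg; apply: measurable_sum => i; apply: measurable_sum => j.
exact: measurable_funM.
Qed.

Lemma in_L2P p q (f : field R d p q) : in_L2 Om f <->
  (forall i j, measurable_fun Om (fun x => f x i j)) /\
  mu.-integrable Om (EFin \o (fun x => frob (f x) (f x))).
Proof.
have e x : `|(frob (f x) (f x))%:E|%E = (frob (f x) (f x))%:E.
  by rewrite /= ger0_norm ?frob_ge0.
split=> -[mf h]; split=> //.
  apply/integrableP; split; first by apply/measurable_EFinP; exact: measurable_frob.
  under eq_integral do rewrite e.
  by move: h; rewrite L2normE; apply: lty_poweRy; rewrite invr_neq0.
move/integrableP : h => [_]; under eq_integral do rewrite e.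
by move=> h; rewrite L2normE poweR_lty.
Qed.

Lemma L2_integrable_frob p q (f g : field R d p q) : in_L2 Om f -> in_L2 Om g ->
  mu.-integrable Om (EFin \o (fun x => frob (f x) (g x))).
Proof.
move=> /in_L2P[mf fi] /in_L2P[mg gi].
apply: (@ae_le_integrable _ _ _ mu Om mOm _
  (fun x => 1 * frob (f x) (f x) + frob (g x) (g x))).
- exact: measurable_frob.
- by apply: aeW => x _; rewrite mul1r frob_le.
- exact: integrable_linR.
Qed.

Lemma in_L2_subspace p q : lin_subspace (@in_L2 R d Om p q).
Proof.
split.
  apply/in_L2P; split; first by move=> i j; rewrite (_ : (fun _ => _) = cst 0) //; apply/funext => x; rewrite mxE.
  rewrite (_ : _ \o _ = cst 0%E); first exact: integrable0.
  apply/funext => x /=; rewrite /frob big1 // => i _; rewrite big1 // => j _.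
  by rewrite mxE mul0r.
move=> c u v uL vL; have /in_L2P[mu_ ui] := uL; have /in_L2P[mv vi] := vL.
have uvi := L2_integrable_frob uL vL; apply/in_L2P; split.
  move=> i j; rewrite (_ : (fun _ => _) = fun x => c * u x i j + v x i j).
    by apply: measurable_funD => //; exact: measurable_funM.
  by apply/funext => x; rewrite !mxE.
rewrite (_ : (fun x => _) = fun x =>
  c ^+ 2 * frob (u x) (u x) + ((2 * c) * frob (u x) (v x) + frob (v x) (v x))).
  by apply: integrable_linR => //; exact: integrable_linR.
apply/funext => x.
rewrite [LHS](_ : _ = frob (c *: u x + v x) (c *: u x + v x)) //.
rewrite frob_linl frobC frob_linl [frob (v x) (_ + _)]frobC frob_linl.
by rewrite [frob (v x) (u x)]frobC; ring.
Qed.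

(** Integration turns a field of bilinear forms that are symmetric and
    nonnegative almost everywhere into a semi-inner product. *)
Lemma semi_inner_Rintegral p q (X : set (field R d p q))
    (beta : 'rV[R]_d -> 'M[R]_(p, q) -> 'M[R]_(p, q) -> R) :
  lin_subspace X ->
  (forall u v, X u -> X v ->
     mu.-integrable Om (EFin \o (fun x => beta x (u x) (v x)))) ->
  (forall x c A B D, beta x (c *: A + B) D = c * beta x A D + beta x B D) ->
  (forall u v, X u -> X v ->
     {ae mu, forall x, Om x -> beta x (u x) (v x) = beta x (v x) (u x)}) ->
  (forall u, X u -> {ae mu, forall x, Om x -> 0 <= beta x (u x) (u x)}) ->
  semi_inner X (fun u v => \int[mu]_(x in Om) beta x (u x) (v x)).
Proof.
move=> XS ib lb sb b0; split => //.
- move=> u v Xu Xv; apply: ae_eq_Rintegral => //; [exact: ib..|exact: sb].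
- move=> c u v w Xu Xv Xw; rewrite -Rintegral_lin //; try exact: ib.
  by apply: eq_Rintegral => x _; rewrite -lb.
- by move=> u Xu; apply: ae_ge0_Rintegral => //; [exact: ib|exact: b0].
Qed.

Lemma semi_inner_L2 p q : semi_inner (@in_L2 R d Om p q) (@L2ip p q).
Proof.
apply: (@semi_inner_Rintegral _ _ _ (fun _ => @frob R p q)).
- exact: in_L2_subspace.
- by move=> u v; exact: L2_integrable_frob.
- by move=> _ c A B D; rewrite frob_linl.
- by move=> u v _ _; apply: aeW => x _; rewrite frobC.
- by move=> u _; apply: aeW => x _; exact: frob_ge0.
Qed.

Lemma L2norm_snorm p q (f : field R d p q) : in_L2 Om f ->
  L2norm Om f = (snorm (@L2ip p q) f)%:E.
Proof.
move=> fL; rewrite L2normE /snorm -powR12_sqrt; last exact: (si_ge0 (semi_inner_L2 p q)).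
rewrite -poweR_EFin /L2ip /Rintegral fineK //.
by apply: integrable_fin_num => //; exact: L2_integrable_frob.
Qed.

End L2.

(** * Semi-inner products *)
(** * The forms a and c *)

Section forms.
Context (R : realType) (d : nat) (Om : set 'rV[R]_d).
Hypothesis mOm : measurable Om.
Let mu : {measure set 'rV[R]_d -> \bar R} := lebesgue_rV R d.

Lemma semi_inner_prod (E1 E2 : lmodType R) (X1 : set E1) (X2 : set E2) B1 B2 :
  semi_inner X1 B1 -> semi_inner X2 B2 ->
  semi_inner (X1 `*` X2) (fun u v : E1 * E2 => B1 u.1 v.1 + B2 u.2 v.2).
Proof.
move=> H1 H2; split.
- split; first by split; [exact: (si_subspace H1).1|exact: (si_subspace H2).1].
  by move=> c u v [? ?] [? ?]; split; [exact: (si_subspace H1).2|exact: (si_subspace H2).2].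
- by move=> u v [? ?] [? ?]; rewrite (si_sym H1) // (si_sym H2).
- move=> c u v w [? ?] [? ?] [? ?] /=.
  by rewrite (si_lin H1) // (si_lin H2) //; ring.
- by move=> u [? ?]; rewrite addr_ge0 // ?(si_ge0 H1) // (si_ge0 H2).
Qed.

Section compliance.
Variables (C Cinv : 'rV[R]_d -> tensor4 R d) (M0 M1 : R).
Hypothesis hC : elasticity_tensor Om C Cinv M0 M1.

(** The compliance tensor is controlled on symmetric matrices only. *)
Definition symL2 : set (field R d d d) :=
  [set t | in_L2 Om t /\ {ae mu, forall x, Om x -> (t x)^T = t x}].

Lemma symL2_subspace : lin_subspace symL2.
Proof.
have [L0 LL] := in_L2_subspace mOm d d.
split; first by split=> //; apply: aeW => x _; apply/matrixP => i j; rewrite !mxE.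
move=> c u v [uL su] [vL sv]; split; first exact: LL.
by apply: filterS2 su sv => x su sv Ox; rewrite linearP /= su // sv.
Qed.

Let form x (A B : 'M[R]_d) := frob (tapp (Cinv x) A) B.

Let form_lin x c A B D : form x (c *: A + B) D = c * form x A D + form x B D.
Proof.
rewrite /form -frob_linl; congr frob; apply/matrixP => i j; rewrite !mxE.
rewrite mulr_sumr -big_split; apply: eq_bigr => k _ /=.
rewrite mulr_sumr -big_split; apply: eq_bigr => l _ /=.
by rewrite !mxE; ring.
Qed.

Let form_sym x A B : symmetric4 (Cinv x) -> form x A B = form x B A.
Proof.
move=> sC; have e D D' : form x D D' =
    \sum_i \sum_j \sum_k \sum_l Cinv x i j k l * D k l * D' i j.
  apply: eq_bigr => i _; apply: eq_bigr => j _; rewrite mxE mulr_suml.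
  by apply: eq_bigr => k _; rewrite mulr_suml.
rewrite !e pair_big /= [RHS]pair_big /=.
under eq_bigr do rewrite pair_big /=.
under [RHS]eq_bigr do rewrite pair_big /=.
rewrite exchange_big /=; apply: eq_bigr => -[i j] _; apply: eq_bigr => -[k l] _ /=.
by rewrite (sC k l i j).2; ring.
Qed.

Let form_ae : {ae mu, forall x, Om x -> symmetric4 (Cinv x) /\
  forall t : 'M[R]_d, t^T = t -> M0 * frob t t <= form x t t <= M1 * frob t t}.
Proof. by case: hC => _ _ _ _; apply: filterS => x h /h[_ [sC _] b]. Qed.

Let M00 : 0 < M0. Proof. by case: hC. Qed.

(** Nonnegativity of the quadratic form at A + B and at B - A. *)
Let form_le x A B : symmetric4 (Cinv x) ->
  (forall t : 'M[R]_d, t^T = t -> M0 * frob t t <= form x t t <= M1 * frob t t) ->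
  A^T = A -> B^T = B -> `|form x A B| <= M1 * frob A A + M1 * frob B B.
Proof.
move=> sC b sA sB.
have e c : 0 <= form x (c *: A + B) (c *: A + B).
  have /andP[h _] : M0 * frob (c *: A + B) (c *: A + B) <= form x (c *: A + B) (c *: A + B)
     <= M1 * frob (c *: A + B) (c *: A + B).
    by apply: b; rewrite linearP /= sA sB.
  by rewrite (le_trans _ h) // mulr_ge0 ?frob_ge0 // ltW.
have := e 1; have := e (-1).
rewrite !form_lin !(form_sym _ (_ + _)) // !form_lin (form_sym B A) //.
have /andP[a1 a2] := b _ sA; have /andP[b1 b2] := b _ sB.
have := mulr_ge0 (ltW M00) (frob_ge0 A); have := mulr_ge0 (ltW M00) (frob_ge0 B).
rewrite ler_norml; lra.
Qed.

Lemma integrable_form_a u v : symL2 u -> symL2 v ->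
  mu.-integrable Om (EFin \o (fun x => frob (tapp (Cinv x) (u x)) (v x))).
Proof.
move=> [uL su] [vL sv].
have /in_L2P[mu_ ui] := uL; have /in_L2P[mv vi] := vL.
apply: (@ae_le_integrable _ _ _ mu Om mOm _
  (fun x => M1 * frob (u x) (u x) + M1 * frob (v x) (v x))).
- apply: measurable_frob => // i j.
  rewrite (_ : (fun _ => _) = fun x => \sum_k \sum_l Cinv x i j k l * u x k l).
    apply: measurable_sum => k; apply: measurable_sum => l.
    by apply: measurable_funM => //; case: hC.
  by apply/funext => x; rewrite mxE.
- apply: filterS3 su sv form_ae => x su sv fx Ox; have [sC b] := fx Ox.
  by apply: form_le => //; [exact: su|exact: sv].
- by apply: integrable_linR => //; exact: integrable_scaleR.
Qed.

Lemma semi_inner_form_a : semi_inner symL2 (form_a Om Cinv).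
Proof.
apply: (@semi_inner_Rintegral _ _ _ mOm _ _ symL2 form).
- exact: symL2_subspace.
- exact: integrable_form_a.
- exact: form_lin.
- move=> u v _ _; apply: filterS form_ae => x h Ox.
  by apply: form_sym; have [] := h Ox.
- move=> u [_ su]; apply: filterS2 su form_ae => x su h Ox.
  have [_ /(_ _ (su Ox))/andP[h1 _]] := h Ox.
  by rewrite (le_trans _ h1) // mulr_ge0 ?frob_ge0 // ltW.
Qed.

Lemma form_a_bounds u : symL2 u ->
  M0 * L2ip Om u u <= form_a Om Cinv u u <= M1 * L2ip Om u u.
Proof.
move=> su; have ai := integrable_form_a su su; have [uL sym_u] := su.
have ui := L2_integrable_frob mOm uL uL.
rewrite /L2ip -!RintegralZl //.
apply/andP; split; apply: ae_le_Rintegral => //; try exact: integrable_scaleR.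
- apply: filterS2 sym_u form_ae => x sx h Ox.
  by have [_ /(_ _ (sx Ox))/andP[h1 _]] := h Ox.
- apply: filterS2 sym_u form_ae => x sx h Ox.
  by have [_ /(_ _ (sx Ox))/andP[_ h1]] := h Ox.
Qed.

End compliance.

Section weight.
Variables (rho : 'rV[R]_d -> R) (rho0 rho1 : R).
Hypothesis hrho : density Om rho rho0 rho1.
Let mrho : measurable_fun Om rho. Proof. by case: hrho. Qed.
Let rho00 : 0 < rho0. Proof. by case: hrho. Qed.
Let brho : {ae mu, forall x, Om x -> rho0 <= rho x <= rho1}.
Proof. by case: hrho. Qed.

Lemma integrable_form_c (u v : field R d 1 d) : in_L2 Om u -> in_L2 Om v ->
  mu.-integrable Om (EFin \o (fun x => rho x * frob (u x) (v x))).
Proof.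
move=> uL vL; have /in_L2P[mu_ ui] := uL; have /in_L2P[mv vi] := vL.
apply: (@ae_le_integrable _ _ _ mu Om mOm _
  (fun x => rho1 * frob (u x) (u x) + rho1 * frob (v x) (v x))).
- by apply: measurable_funM => //; exact: measurable_frob.
- apply: filterS brho => x h /h /andP[r0 r1].
  have r00 := le_trans (ltW rho00) r0.
  rewrite -mulrDr normrM ger0_norm //.
  by apply: ler_pM => //; exact: frob_le.
- by apply: integrable_linR => //; exact: integrable_scaleR.
Qed.

Lemma semi_inner_form_c : semi_inner (@in_L2 R d Om 1 d) (form_c Om rho).
Proof.
apply: (@semi_inner_Rintegral _ _ _ mOm _ _ _ (fun x A B => rho x * frob A B)).
- exact: in_L2_subspace.
- exact: integrable_form_c.
- by move=> x c A B D; rewrite frob_linl; ring.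
- by move=> u v _ _; apply: aeW => x _; rewrite frobC.
- move=> u _; apply: filterS brho => x h /h /andP[r0 _].
  by rewrite mulr_ge0 ?frob_ge0 // (le_trans (ltW rho00)).
Qed.

Lemma form_c_bounds u : in_L2 Om u ->
  rho0 * L2ip Om u u <= form_c Om rho u u <= rho1 * L2ip Om u u.
Proof.
move=> uL; have ci := integrable_form_c uL uL.
have ui := L2_integrable_frob mOm uL uL.
rewrite /L2ip -!RintegralZl //.
apply/andP; split; apply: ae_le_Rintegral => //; try exact: integrable_scaleR.
- by apply: filterS brho => x h /h /andP[r0 _]; rewrite ler_wpM2r ?frob_ge0.
- by apply: filterS brho => x h /h /andP[_ r1]; rewrite ler_wpM2r ?frob_ge0.
Qed.

End weight.
End forms.

(** * Semi-inner products *)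
(** * Continuous functions and bounded sets for the measure on row vectors *)

Lemma measurable_box_rV (R : realType) (n : nat) (S : 'I_n -> set R) :
  (forall i, measurable (S i)) ->
  measurable [set y : 'rV[R]_n | forall i, S i (y ord0 i)].
Proof.
move=> mS; rewrite (_ : mkset _ =
  \bigcap_(i in [set: 'I_n]) ((fun y : 'rV[R]_n => y ord0 i) @^-1` S i)).
  apply: fin_bigcap_measurable => // i _.
  by rewrite -[X in measurable X]setTI; exact: measurable_coor.
by apply/seteqP; split => x; [move=> h i _; exact: h|move=> h i; exact: (h i Logic.I)].
Qed.

Section borel_rV.
Context (R : realType) (d : nat).

(** An open set is the union of the countably many boxes with rational centre and
    radius that it contains. *)
Lemma open_measurable_rV (V : set 'rV[R]_d) : open V -> measurable V.
Proof.
move=> oV.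
pose F (c : {ffun 'I_d -> rat} * rat) := [set y : 'rV[R]_d | forall i,
  `]ratr (c.1 i) - ratr c.2, ratr (c.1 i) + ratr c.2[%classic (y ord0 i)].
pose G n := if unpickle n is Some c then
  (if `[< F c `<=` V >] then F c else set0) else set0.
rewrite (_ : V = \bigcup_n G n).
  apply: bigcupT_measurable => n; rewrite /G; case: unpickle => // c.
  case: asboolP => // _; apply: (measurable_box_rV
    (S := fun i => `]ratr (c.1 i) - ratr c.2, ratr (c.1 i) + ratr c.2[%classic)) => i.
  exact: measurable_itv.
apply/seteqP; split => [x Vx|x [n _]]; last first.
  by rewrite /G; case: unpickle => // c; case: asboolP => // h; exact: h.
have /nbhs_ballP[e /= e0 xeV] : nbhs x V by apply: open_nbhs_nbhs; split.
have [r] : exists r : rat, 0 < (ratr r : R) < e / 2.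
  have /rat_in_itvoo[r] : 0 < e / 2 by rewrite divr_gt0.
  by rewrite in_itv /= => ?; exists r.
move=> /andP[r0 re].
have hq i : exists q : rat, `|x ord0 i - ratr q| < (ratr r : R).
  have /rat_in_itvoo[q] : x ord0 i - ratr r < x ord0 i + ratr r by rewrite ltrD2l gtrN.
  rewrite in_itv /= => /andP[h1 h2]; exists q; rewrite ltr_norml; lra.
have [q qx] := choice hq.
pose c : {ffun 'I_d -> rat} * rat := ([ffun i => q i], r).
exists (pickle c) => //; rewrite /G pickleK.
case: asboolP => [_|]; first by move=> i; rewrite ffunE /= in_itv /= -ltr_distlC distrC; exact: qx.
case=> y Fy; apply: xeV; split => // j i; rewrite (ord1 j) /ball /=.
have := Fy i; rewrite ffunE /= in_itv /= -ltr_distlC => h; have := qx i; move: h re.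
move=> h re h2; rewrite -(subrK (ratr (q i)) (x ord0 i)) -addrA.
apply: le_lt_trans (ler_normD _ _) _; lra.
Qed.

Lemma continuous_measurable_rV (f : 'rV[R]_d -> R) : continuous f ->
  measurable_fun setT f.
Proof.
move=> /continuousP cf; apply: (measurability _ (RGenOpens.measurableE R)).
move=> _ [_ [a [b ->] <-]]; rewrite setTI; apply: open_measurable_rV.
exact/cf/interval_open.
Qed.

End borel_rV.

Lemma lebesgue_rV_box_fin (R : realType) (n : nat) (M : R) :
  (lebesgue_rV R n [set x : 'rV[R]_n |
    (forall i, `[- M, M]%classic (x ord0 i))%R] < +oo)%E.
Proof.
elim: n => [|n IH].
  apply: (@le_lt_trans _ _ 1%E); last exact: ltry.
  by rewrite /= /dirac /= lee_fin indicE; case: (_ \in _).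
pose A := [set x : 'rV[R]_n | forall i, `[- M, M]%classic (x ord0 i)].
have mA : measurable A by exact: (measurable_box_rV (fun=> measurable_itv `[- M, M])).
rewrite /= /lebesgue_step /pushforward.
rewrite (_ : _ @^-1` _ = `[- M, M] `*` A).
  rewrite product_measure1E //; apply: lte_mul_pinfty => //.
  by rewrite ge0_fin_numE //; exact: lebesgue_measure_cc_fin.
have c0 t x (i : 'I_1) : @cons_rV R n (t, x) ord0 (lshift n i) = t.
  by rewrite [LHS]row_mxEl mxE !ord1 eqxx mulr1n.
have cS t x (i : 'I_n) : @cons_rV R n (t, x) ord0 (rshift 1 i) = x ord0 i.
  exact: row_mxEr.
apply/seteqP; split => [[t x] h|[t x] [tM xA] i].
  split => [|i]; first by have := h (lshift n (ord0 : 'I_1)); rewrite /= c0.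
  by have := h (rshift 1 i); rewrite /= cS.
by case: (@split_ordP 1 n i) => j -> /=; rewrite ?c0 // cS; exact: xA.
Qed.

Section test_functions.
Context (R : realType) (d : nat) (Om : set 'rV[R]_d).
Hypothesis mOm : measurable Om.
Hypothesis bOm : exists M : R, forall x, Om x -> fnorm x <= M.
Let mu : {measure set 'rV[R]_d -> \bar R} := lebesgue_rV R d.

Lemma bounded_measure_fin : (mu Om < +oo)%E.
Proof.
have [M hM] := bOm.
apply: le_lt_trans (lebesgue_rV_box_fin d M); apply: le_measure; rewrite ?inE //.
  exact: (measurable_box_rV (fun=> measurable_itv `[- M, M])).
move=> x Ox i /=; rewrite in_itv /= -ler_norml; apply: le_trans (hM _ Ox).
by rewrite /fnorm -sqrtr_sqr ler_wsqrtr // sqr_le_frob.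
Qed.

(** The partial derivatives of a test function vanish off its compact support,
    because the complement of the support is open; on the support they are bounded
    by compactness. *)
Lemma partials_bounded (phi : 'rV[R]_d -> R) s : test_function Om phi ->
  measurable_fun setT (partials s phi) /\ exists M, forall x, `|partials s phi x| <= M.
Proof.
move=> [sphi [K [cK _ phi0]]].
have cont := (sphi s).1; split; first exact: continuous_measurable_rV.
have clK : closed K by apply: compact_closed => //; exact: norm_hausdorff.
have zero x : ~ K x -> partials s phi x = 0.
  elim: s {cont} x => [|i s IH] x Kx; first exact: phi0.
  rewrite /= /partial (@near_eq_derive _ _ _ _ (cst 0)) ?derive_cst //.
  have : \near x, (~` K) x by apply: open_nbhs_nbhs; split => //; exact: closed_openC.
  by apply: filterS => z; exact: IH.
have [K0|/set0P K0] := eqVneq K set0.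
  by exists 0 => x; rewrite zero ?normr0 // K0.
have [|c _ hc] := @EVT_max_rV R d (fun x => `|partials s phi x|) K K0 cK.
  apply: continuous_subspaceT => x.
  by apply: (@continuous_comp _ _ _ (partials s phi) Num.norm); [exact: cont|exact: norm_continuous].
exists `|partials s phi c| => x.
have [Kx|nKx] := pselect (K x); first by apply: hc; rewrite inE.
by rewrite zero // normr0.
Qed.

(** Without this integrability the integrals that define weak derivatives would
    not be additive in f. *)
Lemma integrable_L2_test p q (f : field R d p q) phi s i j :
  in_L2 Om f -> test_function Om phi ->
  mu.-integrable Om (EFin \o (fun x => f x i j * partials s phi x)).
Proof.
move=> /in_L2P[mf fi] tphi; have [mpsi [M hM]] := partials_bounded s tphi.
apply: (@ae_le_integrable _ _ _ mu Om mOm _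
  (fun x => 1 * frob (f x) (f x) + M ^+ 2)).
- by apply: measurable_funM => //; exact: measurable_funTS.
- apply: aeW => x _; rewrite normrM mul1r.
  have := sqr_le_frob (f x) i j; rewrite -[f x i j ^+ 2]real_normK ?num_real //.
  have := hM x; have := normr_ge0 (partials s phi x); have := normr_ge0 (f x i j).
  move: (`|_|) (`|_|) (frob _ _) => a b c a0 b0 bM ac.
  have := ler_wpM2l a0 bM; have := sqr_ge0 (b - M); have := sqr_ge0 b.
  have := sqr_ge0 M; nra.
- apply: integrable_linR => //.
  apply/integrableP; split; first exact: measurable_cst.
  rewrite /= integral_cst // lte_mul_pinfty ?lee_fin //; exact: bounded_measure_fin.
Qed.

End test_functions.

(** * Semi-inner products *)
(** * The Sobolev norm is a seminorm *)

Section sobolev.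
Context (R : realType) (d : nat) (Om : set 'rV[R]_d).
Hypothesis mOm : measurable Om.
Hypothesis bOm : exists M : R, forall x, Om x -> fnorm x <= M.
Let mu : {measure set 'rV[R]_d -> \bar R} := lebesgue_rV R d.
Variables (p q r : nat).

Lemma weak_jet_lin (c : R) (f1 f2 : field R d p q) (g1 g2 : multi_index d r -> field R d p q) :
  weak_jet Om f1 g1 -> weak_jet Om f2 g2 ->
  weak_jet Om (c *: f1 + f2) (c *: g1 + g2).
Proof.
have [_ LL] := in_L2_subspace mOm p q.
move=> [f1L J1] [f2L J2]; split; first exact: LL.
move=> a ar; have [g1L D1] := J1 a ar; have [g2L D2] := J2 a ar.
split; first exact: LL.
move=> phi tphi i j.
have lin (u v : field R d p q) s : in_L2 Om u -> in_L2 Om v ->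
    \int[mu]_(x in Om) ((c *: u + v) x i j * partials s phi x) =
    c * \int[mu]_(x in Om) (u x i j * partials s phi x) +
    \int[mu]_(x in Om) (v x i j * partials s phi x).
  move=> uL vL; rewrite -Rintegral_lin //; try exact: integrable_L2_test.
  by apply: eq_Rintegral => x _; rewrite !mxE; ring.
rewrite lin // (lin _ _ [::]) // D1 // D2 //=; ring.
Qed.

Lemma weak_jet0 : weak_jet Om (0 : field R d p q) (0 : multi_index d r -> field R d p q).
Proof.
have [L0 _] := in_L2_subspace mOm p q.
split=> // a _; split=> // phi _ i j.
have z psi : \int[mu]_(x in Om) ((0 : field R d p q) x i j * psi x) = 0.
  rewrite /Rintegral (eq_integral (cst 0%E)) ?integral0 // => x _.
  by rewrite mxE mul0r.
by rewrite !z mulr0.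
Qed.

Let jets : set (multi_index d r -> field R d p q) :=
  [set g | forall a : multi_index d r, (\sum_i a i <= r)%N -> in_L2 Om (g a)].

(** The sum in the definition of the Sobolev norm is the square of the seminorm of
    a semi-inner product on families of weak derivatives. *)
Let jet_ip (g h : multi_index d r -> field R d p q) : R :=
  \sum_(a : multi_index d r | (\sum_i a i <= r)%N) L2ip Om (g a) (h a).

Let semi_inner_jet : semi_inner jets jet_ip.
Proof.
have H := semi_inner_L2 mOm p q; have [L0 LL] := in_L2_subspace mOm p q.
split.
- split; first by move=> a _; exact: L0.
  by move=> c u v hu hv a ar; apply: LL; [exact: hu|exact: hv].
- by move=> u v hu hv; apply: eq_bigr => a ar; rewrite (si_sym H) //; [exact: hu|exact: hv].
- move=> c u v w hu hv hw; rewrite /jet_ip mulr_sumr -big_split; apply: eq_bigr => a ar /=.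
  by rewrite -(si_lin H) //; [exact: hu|exact: hv|exact: hw].
- by move=> u hu; apply: sumr_ge0 => a ar; apply: (si_ge0 H); exact: hu.
Qed.

Let jet_norm g : jets g ->
  ((\sum_(a : multi_index d r | (\sum_i a i <= r)%N) L2norm Om (g a) ^+ 2) `^ 2^-1)%E
  = (snorm jet_ip g)%:E.
Proof.
move=> hg; have H := semi_inner_L2 mOm p q.
rewrite /snorm -powR12_sqrt; last exact: (si_ge0 semi_inner_jet).
rewrite -poweR_EFin /jet_ip -sumEFin; congr (_ `^ _)%E; apply: eq_bigr => a ar.
rewrite (L2norm_snorm mOm (hg a ar)) -(snorm_sqr H) //; exact: hg.
Qed.

Let weak_jet_jets f g : weak_jet Om f g -> jets g.
Proof. by move=> [_ h] a ar; have [] := h a ar. Qed.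

Local Notation N := (@Hnorm R d Om p q r).

Lemma Hnorm_ge0 f : (0 <= N f)%E.
Proof.
by apply: le_ereal_inf_tmp => _ [g jg <-]; exact: poweR_ge0.
Qed.

Lemma Hnorm_lty f : in_H Om r f -> (N f < +oo)%E.
Proof.
move=> [g jg]; apply: (@le_lt_trans _ _ (snorm jet_ip g)%:E); last exact: ltry.
rewrite -jet_norm; last exact: weak_jet_jets jg.
by apply: ereal_inf_lbound; exists g.
Qed.

Lemma Hnorm0 : N 0 = 0%E.
Proof.
apply/eqP; rewrite eq_le Hnorm_ge0 andbT.
apply: (@le_trans _ _ (snorm jet_ip 0)%:E).
  rewrite -jet_norm; last exact: weak_jet_jets weak_jet0.
  by apply: ereal_inf_lbound; exists 0 => //; exact: weak_jet0.
by rewrite -(scale0r 0) (snormZ semi_inner_jet) ?normr0 ?mul0r //; exact: weak_jet_jets weak_jet0.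
Qed.

(** Families of weak derivatives can be subtracted, and the triangle inequality
    for each pair of families passes to the infimum.  Outside of H^r the norm is
    +oo. *)
Lemma HnormB f g : (N (f - g)%R <= N f + N g)%E.
Proof.
have noH u : ~ in_H Om r u -> N u = +oo%E.
  move=> nu; rewrite /Hnorm (_ : image _ _ = set0) ?ereal_inf0 //.
  by apply/seteqP; split => // x [h jh _]; apply: nu; exists h.
have [fH|nf] := pselect (in_H Om r f); last first.
  by rewrite (noH f) // addye ?leey // gt_eqF // (lt_le_trans _ (Hnorm_ge0 g)) // ltNyr.
have [gH|ng] := pselect (in_H Om r g); last first.
  by rewrite (noH g) // addey ?leey // gt_eqF // (lt_le_trans _ (Hnorm_ge0 f)) // ltNyr.
have ff : N f \is a fin_num by rewrite ge0_fin_numE ?Hnorm_ge0 // Hnorm_lty.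
have gf : N g \is a fin_num by rewrite ge0_fin_numE ?Hnorm_ge0 // Hnorm_lty.
apply/lee_addgt0Pr => e e0; have e20 : 0 < e / 2 by rewrite divr_gt0.
have [_ [jf jfh <-] fe] := lb_ereal_inf_adherent e20 ff.
have [_ [jg jgh <-] ge] := lb_ereal_inf_adherent e20 gf.
have jfj := weak_jet_jets jfh; have jgj := weak_jet_jets jgh.
have jfg : weak_jet Om (f - g) (jf - jg).
  have := weak_jet_lin (-1) jgh jfh; rewrite !scaleN1r.
  by rewrite [- g + f]addrC [- jg + jf]addrC.
apply: (@le_trans _ _ (snorm jet_ip (jf - jg))%:E).
  rewrite -jet_norm; last exact: weak_jet_jets jfg.
  by apply: ereal_inf_lbound; exists (jf - jg).
apply: (@le_trans _ _ ((snorm jet_ip jf)%:E + (snorm jet_ip jg)%:E)%E).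
  by rewrite -EFinD lee_fin (snormB semi_inner_jet).
rewrite -!jet_norm // [e]splitr EFinD addeACA; apply: leeD; exact: ltW.
Qed.

End sobolev.

(** * Measurability in time of a strongly measurable function *)

Section bochner.
Context (R : realType) (E : lmodType R) (X : set E) (N : E -> \bar R) (T : R).
Hypothesis N0 : forall x, (0 <= N x)%E.
Hypothesis Nz : N 0 = 0%E.
Hypothesis NB : forall x y, (N (x - y)%R <= N x + N y)%E.
Local Notation mu := (@lebesgue_measure R).

Let ND x y : (N (x + y)%R <= N x + N y)%E.
Proof.
rewrite -{1}(opprK y); apply: le_trans (NB _ _) _; rewrite leeD2l // -[- y]add0r.
by apply: le_trans (NB _ _) _; rewrite Nz add0e.
Qed.

(** Such a function takes one value for each b, the indicator of the indices k for
    which t lies in A k. *)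
Lemma measurable_simple_function s : simple_function X s ->
  measurable_fun setT (fun t => N (s t)).
Proof.
move=> [n [A [x [Ax ->]]]] _ Y mY; rewrite setTI.
pose S (b : {ffun 'I_n -> bool}) := \sum_k (b k)%:R *: x k.
rewrite (_ : _ @^-1` Y = \bigcup_(b in [set b | Y (N (S b))])
  \bigcap_(k in [set: 'I_n]) (if b k then A k else ~` A k)).
  apply: fin_bigcup_measurable => [|b _]; first exact: finite_finset.
  apply: fin_bigcap_measurable => // k _; have [mA _] := Ax k.
  by case: (b k) => //; exact: measurableC.
apply/seteqP; split => [t /= Yt|t [b /= Yb bt]].
  exists [ffun k => t \in A k] => /=.
    rewrite /S (_ : \sum_k _ = \sum_k (\1_(A k) t : R) *: x k) //.
    by apply: eq_bigr => k _; rewrite ffunE indicE.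
  by move=> k _; rewrite ffunE; case: ifPn => [/set_mem //|/negP nA] /= /mem_set.
rewrite /= (_ : \sum_k _ = S b) //; apply: eq_bigr => k _; rewrite indicE.
have := bt k Logic.I; case: (b k) => At; first by rewrite mem_set.
by rewrite memNset.
Qed.

(** By the triangle inequality N (u t) is the limit of N (s n t) at almost every
    t.  Only almost everywhere: the Borel sigma-algebra is not complete, so the
    norm is measurable on a subset D of full measure. *)
Lemma bochner_norm_measurable u : {ae mu, forall t, 0 <= t <= T -> (N (u t) < +oo)%E} ->
  bochner_measurable X N T u ->
  exists D, [/\ measurable D, D `<=` `[0, T],
    {ae mu, forall t, 0 <= t <= T -> D t} & measurable_fun D (fun t => N (u t))].
Proof.
move=> [N1 [mN1 N10 h1]] [s [ss [N2 [mN2 N20 h2]]]].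
exists (`[0, T] `\` (N1 `|` N2)); split.
- by apply: measurableD => //; exact: measurableU.
- exact: subDsetl.
- exists (N1 `|` N2); split => //; first exact: measurableU.
    by rewrite measureU0.
  move=> t /= ht; apply: contrapT => nN; by apply: ht => t0T; split.
apply: (emeasurable_fun_cvg (fun n t => N (s n t))).
  by move=> n; apply: measurable_funTS; exact: measurable_simple_function.
move=> t [/=]; rewrite in_itv /= => t0T /not_orP[n1 n2].
have Nfin : N (u t) \is a fin_num.
  rewrite ge0_fin_numE //; apply: contrapT => h; apply: n1; apply: h1 => /=.
  by move=> /(_ t0T).
have cv : N (s n t - u t) @[n --> \oo] --> 0%E.
  by apply: contrapT => h; apply: n2; apply: h2 => /= /(_ t0T).
have /fine_cvgP[dfin _] := cv.
apply: (@squeeze_cvge _ _ _ _ (fun n => N (u t) - N (s n t - u t)%R)%E _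
   (fun n => N (u t) + N (s n t - u t)%R)%E).
- apply: filterS dfin => n dn; apply/andP; split.
    rewrite leeBlDr //; have := NB (s n t) (s n t - u t).
    by rewrite opprB addrC subrK.
  by rewrite -{1}(subrK (u t) (s n t)) addrC; exact: ND.
- rewrite -[X in _ --> X]sube0; apply: cvgeB => //; first by rewrite fin_num_adde_defl.
  exact: cvg_cst.
- rewrite -[X in _ --> X]adde0; apply: cvgeD => //; first by rewrite fin_num_adde_defl.
  exact: cvg_cst.
Qed.

End bochner.

(** * Semi-inner products *)
(** * Lebesgue norms in time *)

Section time_norms.
Context (R : realType).
Local Notation mu := (@lebesgue_measure R).

Lemma lebesgue_ae_mono (P Q : R -> Prop) : (forall t, P t -> Q t) ->
  {ae mu, forall t, P t} -> {ae mu, forall t, Q t}.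
Proof.
move=> PQ [M [mM M0 hM]]; exists M; split => // t nQ.
by apply: hM => /PQ.
Qed.

Lemma lebesgue_ae_and (P Q : R -> Prop) : {ae mu, forall t, P t} ->
  {ae mu, forall t, Q t} -> {ae mu, forall t, P t /\ Q t}.
Proof.
move=> [M [mM M0 hM]] [M' [mM' M'0 hM']]; exists (M `|` M'); split.
- exact: measurableU.
- by rewrite measureU0.
- move=> t /= /not_andP[nP|nQ]; [left; exact: hM|right; exact: hM'].
Qed.

(** The integral of a nonnegative function is a supremum over the simple
    functions below it, hence monotone also at functions that may fail to be
    measurable. *)
Lemma le_lower_integral (f g : R -> \bar R) :
  (forall t, 0 <= f t)%E -> (forall t, f t <= g t)%E ->
  (\int[mu]_t f t <= \int[mu]_t g t)%E.
Proof.
move=> f0 fg; have g0 t : (0 <= g t)%E by exact: le_trans (f0 t) (fg t).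
rewrite !ge0_integralTE //; apply: ereal_sup_le => _ [h hf <-]; exists h => //.
by move=> t; exact: le_trans (hf t) (fg t).
Qed.

Lemma sqr_poweR (x : \bar R) : (0 <= x)%E -> (x `^ 2 = x * x)%E.
Proof.
case: x => [r|_|//]; last by rewrite poweRyr // mulyy.
by rewrite lee_fin => r0; rewrite poweR_EFin powR_mulrn // expr2 EFinM.
Qed.

Variables (E : lmodType R) (X : set E) (N : E -> \bar R) (T : R).
Hypothesis N0 : forall x, (0 <= N x)%E.

Lemma Lp_norm_ge0 p (u : R -> E) : (0 <= Lp_norm N T p u)%E.
Proof. exact: Lnorm_ge0. Qed.

Lemma lebesgue_measure_setT_gt0 : (0 < mu setT)%E.
Proof.
apply: (@lt_le_trans _ _ (mu `[0, 1])).
  by rewrite lebesgue_measure_cc // subr0 lte_fin.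
by apply: le_measure; rewrite ?inE.
Qed.

Lemma ae_le_Lp_norm_pinfty (u : R -> E) :
  {ae mu, forall t, 0 <= t <= T -> (N (u t) <= Lp_norm N T +oo u)%E}.
Proof.
rewrite /Lp_norm unlock lebesgue_measure_setT_gt0.
apply: filterS (ess_sup_ge mu (abse \o ((fun t => N (u t)) \_ `[0, T]))) => t /= h t0T; apply: le_trans h.
have tin : t \in `[0, T]%classic by rewrite inE /= in_itv.
by rewrite /= /patch tin gee0_abs.
Qed.

Lemma Lp_norm_pinfty_le (u : R -> E) c : (0 <= c)%E ->
  {ae mu, forall t, 0 <= t <= T -> (N (u t) <= c)%E} ->
  (Lp_norm N T +oo u <= c)%E.
Proof.
move=> c0 uc; rewrite /Lp_norm unlock lebesgue_measure_setT_gt0.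
apply/ess_supP; apply: lebesgue_ae_mono uc => t h /=; rewrite /patch; case: ifPn.
  by move=> /set_mem /=; rewrite in_itv /= => /h; rewrite gee0_abs.
by rewrite abse0.
Qed.

Hypothesis Nz : N 0 = 0%E.
Hypothesis NB : forall x y, (N (x - y)%R <= N x + N y)%E.

(** The norm t |-> N (u t) may fail to be measurable on a null set; A replaces it
    by 0 there.  Integrals of sums of such functions can then be split. *)
Lemma bochner_sqr_majorant u : {ae mu, forall t, 0 <= t <= T -> (N (u t) < +oo)%E} ->
  bochner_measurable X N T u ->
  exists A : R -> \bar R, [/\ measurable_fun setT A, forall t, (0 <= A t)%E,
    {ae mu, forall t, 0 <= t <= T -> A t = N (u t)} &
    (\int[mu]_t (A t * A t) <= Lp_norm N T 2%:E u * Lp_norm N T 2%:E u)%E].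
Proof.
move=> ufin ub; have [D [mD DT aeD mNu]] := bochner_norm_measurable N0 Nz NB ufin ub.
pose A := (fun t => N (u t)) \_ D.
have A0 t : (0 <= A t)%E by rewrite /A /patch; case: ifP.
exists A; split => //.
- exact/(measurable_restrictT _ mD).
- by apply: lebesgue_ae_mono aeD => t h /h Dt; rewrite /A /patch mem_set.
have I0 : (0 <= \int[mu]_t (`|((fun s => N (u s)) \_ `[0%R, T]) t| `^ 2))%E.
  by apply: integral_ge0 => t _; exact: poweR_ge0.
rewrite /Lp_norm unlock -sqr_poweR ?poweR_ge0 // -poweRrM mulVf // poweRe1 //.
apply: le_lower_integral => t; first exact: mule_ge0.
rewrite -sqr_poweR //; apply: gt0_ler_poweR => //.
- by rewrite in_itv /= A0 leey.
- by rewrite in_itv /= abse_ge0 leey.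
rewrite /A /patch; case: ifPn => [/set_mem Dt|_]; last exact: abse_ge0.
by rewrite mem_set ?gee0_abs //; exact: DT.
Qed.

End time_norms.

(** * Differentiability in time with respect to a seminorm *)

Section time_derivatives.
Context (R : realType) (T : R).

(** Transfers a derivative in the norm N to the seminorm of the image under a
    linear map pr: the first component of an element of H(div), or the identity. *)
Lemma time_derivative_snorm (E E' : lmodType R) (Y : set E) (X : set E')
    (N : E -> \bar R) (B : E' -> E' -> R) (pr : E -> E') (u du : R -> E) :
  semi_inner X B -> (forall c x y, pr (c *: x + y) = c *: pr x + pr y) ->
  (forall x, X (pr x) -> ((snorm B (pr x))%:E <= N x)%E) ->
  (forall t, 0 <= t <= T -> X (pr (u t))) ->
  (forall t, 0 <= t <= T -> X (pr (du t))) ->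
  time_derivative Y N T u du ->
  has_time_derivative T (snorm B) (fun t => pr (u t)) (fun t => pr (du t)).
Proof.
move=> H prL BN Xu Xdu hd t tT e e0.
have XS := si_subspace H.
have [_ cv] := hd t tT.
have /fine_cvgP[fin /cvgrPdist_lt/(_ e e0) dist] := cv.
pose q s := (s - t)^-1 *: (u s - u t) - du t.
have near_t : nbhs t (fun s => s != t -> `[0, T]%classic s ->
    N (q s) \is a fin_num /\ `|0 - fine (N (q s))| < e).
  exact: filterI fin dist.
have : nbhs t [set s | s != t -> 0 <= s <= T -> (N (q s) < e%:E)%E].
  apply: filterS near_t => s h st sT.
  have [|Nf] := h st; first by rewrite /= in_itv.
  rewrite sub0r normrN => /(le_lt_trans (ler_norm _)).
  by rewrite -lte_fin fineK.
move=> /nbhs_ballP[d d0 hb]; exists d => // s sT sd.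
have Xs := Xu _ sT; have Xt := Xu _ tT; have Xdt := Xdu _ tT.
have [->|st] := eqVneq s t.
  rewrite !subrr normr0 mulr0 scale0r subr0 -(scale0r 0) (snormZ H) ?normr0 ?mul0r //.
  exact: XS.1.
have pr0 : pr 0 = 0.
  by have := prL 1 0 0; rewrite !scale1r addr0 => /esym/(canRL (addrK _)); rewrite subrr.
have prZ c x : pr (c *: x) = c *: pr x by rewrite -[c *: x]addr0 prL pr0 addr0.
have prB x y : pr (x - y) = pr x - pr y.
  by rewrite addrC -scaleN1r prL scaleN1r addrC.
have st0 : s - t != 0 by rewrite subr_eq0.
have prq : pr (q s) = (s - t)^-1 *: (pr (u s) - pr (u t)) - pr (du t) by rewrite prB prZ prB.
have Xq : X (pr (q s)).
  by rewrite prq; apply: subspaceB => //; apply: subspaceZ => //; exact: subspaceB.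
have -> : pr (u s) - pr (u t) - (s - t) *: pr (du t) =
   (s - t) *: pr (q s).
  by rewrite prq scalerBr scalerA divff // scale1r.
rewrite (snormZ H) // mulrC ler_wpM2r // -lee_fin.
apply: le_trans (BN _ Xq) _; apply: ltW; apply: hb => //.
by rewrite /ball /= distrC.
Qed.

Lemma has_time_derivativeB (E : lmodType R) (X : set E) (B : E -> E -> R)
    (u du w dw : R -> E) : semi_inner X B ->
  (forall t, 0 <= t <= T -> [/\ X (u t), X (du t), X (w t) & X (dw t)]) ->
  has_time_derivative T (snorm B) u du -> has_time_derivative T (snorm B) w dw ->
  has_time_derivative T (snorm B) (fun t => u t - w t) (fun t => du t - dw t).
Proof.
move=> H hX hu hw t tT e e0; have XS := si_subspace H.
have e20 : 0 < e / 2 by rewrite divr_gt0.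
have [d1 d10 h1] := hu t tT _ e20; have [d2 d20 h2] := hw t tT _ e20.
exists (Num.min d1 d2); first by rewrite lt_min d10.
move=> s sT; rewrite lt_min => /andP[sd1 sd2].
have [Xu Xdu Xw Xdw] := hX t tT; have [Xus _ Xws _] := hX s sT.
have -> : u s - w s - (u t - w t) - (s - t) *: (du t - dw t) =
  (u s - u t - (s - t) *: du t) - (w s - w t - (s - t) *: dw t).
  have subACA (a b c z : E) : (a - b) - (c - z) = (a - c) - (b - z).
    by rewrite opprD addrACA -opprD.
  by rewrite scalerBr subACA [LHS]subACA.
apply: le_trans (snormB H _ _) _; try do !apply: subspaceB => //; try exact: subspaceZ.
apply: le_trans (lerD (h1 s sT sd1) (h2 s sT sd2)) _.
by rewrite -mulrDl -splitr.
Qed.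

Lemma has_time_derivative_pair (E1 E2 : lmodType R) (X1 : set E1) (X2 : set E2)
    (N1 : E1 -> R) (N2 : E2 -> R) (N : E1 * E2 -> R) (K : R) u du w dw :
  lin_subspace X1 -> lin_subspace X2 ->
  0 < K -> (forall x y, X1 x -> X2 y -> N (x, y) <= K * (N1 x + N2 y)) ->
  (forall t, 0 <= t <= T -> X1 (u t) /\ X1 (du t)) ->
  (forall t, 0 <= t <= T -> X2 (w t) /\ X2 (dw t)) ->
  has_time_derivative T N1 u du -> has_time_derivative T N2 w dw ->
  has_time_derivative T N (fun t => (u t, w t)) (fun t => (du t, dw t)).
Proof.
move=> S1 S2 K0 NK Xu Xw hu hw t tT e e0.
have e20 : 0 < e / (2 * K) by rewrite divr_gt0 // mulr_gt0.
have [d1 d10 h1] := hu t tT _ e20; have [d2 d20 h2] := hw t tT _ e20.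
exists (Num.min d1 d2); first by rewrite lt_min d10.
move=> s sT; rewrite lt_min => /andP[sd1 sd2].
have [Xut Xdut] := Xu t tT; have [Xus _] := Xu s sT.
have [Xwt Xdwt] := Xw t tT; have [Xws _] := Xw s sT.
apply: le_trans (NK _ _ _ _) _.
- by apply: subspaceB => //; [exact: subspaceB|exact: subspaceZ].
- by apply: subspaceB => //; [exact: subspaceB|exact: subspaceZ].
apply: le_trans (ler_wpM2l (ltW K0) (lerD (h1 s sT sd1) (h2 s sT sd2))) _.
by rewrite le_eqVlt; apply/orP; left; apply/eqP; field; rewrite gt_eqF.
Qed.

(** A full-measure set of times meets every interval, so a bound for almost
    every time passes to the initial time by continuity. *)
Lemma snorm_le_initial (E : lmodType R) (X : set E) (B : E -> E -> R)
    (u du : R -> E) (c : R) : semi_inner X B -> 0 < T ->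
  (forall t, 0 <= t <= T -> X (u t) /\ X (du t)) ->
  has_time_derivative T (snorm B) u du ->
  {ae @lebesgue_measure R, forall t, 0 <= t <= T -> snorm B (u t) <= c} ->
  snorm B (u 0) <= c.
Proof.
move=> H T0 hX hd [N [mN N0 hN]]; have XS := si_subspace H.
have zT : 0 <= (0 : R) <= T by rewrite lexx ltW.
have [Xu0 Xdu0] := hX 0 zT.
apply/ler_addgt0Pr => e e0.
have [d d0 h] := hd 0 zT 1 ltr01.
pose K := 1 + snorm B (du 0).
have K0 : 0 < K by rewrite ltr_pwDl // snorm_ge0.
pose d' := Num.min (d / 2) (Num.min T (e / K)).
have d'0 : 0 < d' by rewrite !lt_min T0 !divr_gt0.
have [s [/= sd sN]] : exists s, `[0, d']%classic s /\ ~ N s.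
  apply: contrapT => hs.
  have : (@lebesgue_measure R `[0%R, d']%classic <= @lebesgue_measure R N)%E.
    apply: le_measure; rewrite ?inE // => s sd; apply: contrapT => Ns.
    by apply: hs; exists s.
  by rewrite N0 lebesgue_measure_cc ?(ltW d'0) // subr0 lee_fin leNgt d'0.
move: sd; rewrite in_itv /= => /andP[s0 sd].
have sT : 0 <= s <= T by rewrite s0 (le_trans sd) // !ge_min lexx !orbT.
have sdd : `|s - 0| < d.
  rewrite subr0 ger0_norm // (le_lt_trans sd) // gt_min ltr_pdivrMr //.
  by rewrite mulr_natr mulr2n ltrDl d0.
have sK : s * K <= e.
  by rewrite -ler_pdivlMr // (le_trans sd) // !ge_min lexx !orbT.
have [Xus _] := hX s sT.
have us : snorm B (u s) <= c by apply: contrapT => hc; apply: sN; apply: hN => /= /(_ sT).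
have := h s sT sdd; rewrite subr0 ger0_norm // mul1r => hs.
have -> : u 0 = u s - (u s - u 0 - s *: du 0) - s *: du 0.
  by rewrite -addrA -opprD subrK opprB addrC subrK.
apply: le_trans (snormB H _ _) _.
- by do !apply: subspaceB => //; exact: subspaceZ.
- exact: subspaceZ.
rewrite (snormZ H) // ger0_norm //.
have := snormB H Xus (_ : X (u s - u 0 - s *: du 0)).
have Xr : X (u s - u 0 - s *: du 0) by do !apply: subspaceB => //; exact: subspaceZ.
move=> /(_ Xr); move: sK; rewrite /K; nra.
Qed.

End time_derivatives.

(** * Semi-inner products *)
(** * The semi-discrete error in terms of the elliptic projection *)

Lemma semi_inner_sub (R : realType) (E : lmodType R) (X Y : set E) B :
  lin_subspace Y -> Y `<=` X -> semi_inner X B -> semi_inner Y B.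
Proof.
move=> YS YX H; split => //.
- by move=> u v /YX ? /YX ?; exact: (si_sym H).
- by move=> c u v w /YX ? /YX ? /YX ?; exact: (si_lin H).
- by move=> u /YX ?; exact: (si_ge0 H).
Qed.

Section discretization.
Context (R : realType) (d : nat) (Om : set 'rV[R]_d) (T : R).
Hypothesis mOm : measurable Om.
Hypothesis T0 : 0 < T.
Variables (rho : 'rV[R]_d -> R) (rho0 rho1 : R).
Hypothesis hrho : density Om rho rho0 rho1.
Variables (C Cinv : 'rV[R]_d -> tensor4 R d) (M0 M1 : R).
Hypothesis hC : elasticity_tensor Om C Cinv M0 M1.

Local Notation L2f := (@in_L2 R d Om 1 d).
Local Notation nS := (snorm (@L2ip R d Om d d)).
Local Notation nV := (snorm (@L2ip R d Om 1 d)).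
Local Notation a := (form_a Om Cinv).
Local Notation b := (@form_b R d Om).
Local Notation c := (form_c Om rho).

Let X : set (field R d d d * field R d 1 d) := symL2 Om `*` L2f.
Let P (x y : field R d d d * field R d 1 d) : R := L2ip Om x.1 y.1 + L2ip Om x.2 y.2.
Let B (x y : field R d d d * field R d 1 d) : R := a x.1 y.1 + c x.2 y.2.

Let HS : semi_inner (symL2 Om) (@L2ip R d Om d d).
Proof.
apply: semi_inner_sub (semi_inner_L2 mOm d d); first exact: symL2_subspace.
by move=> u [].
Qed.

Let HV : semi_inner L2f (@L2ip R d Om 1 d) := semi_inner_L2 mOm 1 d.
Let HP : semi_inner X P := semi_inner_prod HS HV.
Let Ha := semi_inner_form_a mOm hC.
Let Hc := semi_inner_form_c mOm hrho.
Let HB : semi_inner X B := semi_inner_prod Ha Hc.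

Let c0 := Num.min M0 rho0.
Let c1 := Num.max M1 rho1.

Let c00 : 0 < c0.
Proof. by rewrite lt_min; case: hC => _ _ -> _ _; case: hrho. Qed.

Let c10 : 0 < c1.
Proof. by rewrite lt_max; case: hC => _ _ _ -> _. Qed.

Let B_bounds x : X x -> c0 * P x x <= B x x <= c1 * P x x.
Proof.
move=> [x1 x2]; have /andP[a1 a2] := form_a_bounds mOm hC x1.
have /andP[b1 b2] := form_c_bounds mOm hrho x2.
have s1 := si_ge0 HS x1; have s2 := si_ge0 HV x2.
rewrite /P /B !mulrDr; apply/andP; split; apply: lerD.
- by apply: le_trans a1; rewrite ler_wpM2r // ge_min lexx.
- by apply: le_trans b1; rewrite ler_wpM2r // ge_min lexx orbT.
- by apply: le_trans a2 _; rewrite ler_wpM2r // le_max lexx.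
- by apply: le_trans b2 _; rewrite ler_wpM2r // le_max lexx orbT.
Qed.

(** Below, P is the L2 product of pairs (tensor, velocity), and B = a + c is
    equivalent to it with constants c0 and c1. *)
Let snormP_le x y : symL2 Om x -> L2f y -> snorm P (x, y) <= nS x + nV y.
Proof.
move=> sx ly; rewrite -(@ler_pXn2r _ 2) ?nnegrE ?addr_ge0 ?snorm_ge0 //.
rewrite (snorm_sqr HP) // sqrrD (snorm_sqr HS) // (snorm_sqr HV) // /P /=.
by rewrite lerD2r lerDl mulrn_wge0 // mulr_ge0 // snorm_ge0.
Qed.

Let nS_le x : X x -> nS x.1 <= snorm P x.
Proof. by move=> [x1 x2]; rewrite ler_wsqrtr // /P lerDl (si_ge0 HV). Qed.

Let nV_le x : X x -> nV x.2 <= snorm P x.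
Proof. by move=> [x1 x2]; rewrite ler_wsqrtr // /P lerDr (si_ge0 HS). Qed.

Let snormB_le x : X x -> snorm B x <= Num.sqrt c1 * snorm P x.
Proof.
by move=> Xx; rewrite -sqrtrM ?(ltW c10) // ler_wsqrtr //; have /andP[] := B_bounds Xx.
Qed.

Let in_Hdiv_sym tau : in_Hdiv Om tau -> symL2 Om tau.1.
Proof. by case. Qed.

Let in_Hdiv_div tau : in_Hdiv Om tau -> L2f tau.2.
Proof. by case. Qed.

Let L2norm_Hdivnorm tau : symL2 Om tau.1 -> ((nS tau.1)%:E <= Hdivnorm Om tau)%E.
Proof.
move=> [tL _]; rewrite -(L2norm_snorm mOm tL) /Hdivnorm.
have root : L2norm Om tau.1 = ((L2norm Om tau.1 ^+ 2) `^ 2^-1)%E.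
  by rewrite expe2 -sqr_poweR ?L2norm_ge0 // -poweRrM mulfV // poweRe1 ?L2norm_ge0.
rewrite [X in (X <= _)%E]root; apply: gt0_ler_poweR => //.
- by rewrite in_itv /= leey andbT sqre_ge0.
- by rewrite in_itv /= adde_ge0 ?leey // sqre_ge0.
- by rewrite leeDl // sqre_ge0.
Qed.

Variables (f : R -> field R d 1 d).
Variables (sigma dsigma : R -> tensor_div R d) (v dv : R -> field R d 1 d).
Hypothesis hsigma : C1_in (in_Hdiv Om) (Hdivnorm Om) T sigma dsigma.
Hypothesis hv : C1_in L2f (@L2norm R d Om 1 d) T v dv.
Variables (Hh : set (tensor_div R d)) (Vh : set (field R d 1 d)).
Hypothesis hHh : finite_dim_subspace (in_Hdiv Om) (Hdivnorm Om) Hh.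
Hypothesis hVh : finite_dim_subspace L2f (@L2norm R d Om 1 d) Vh.
Variables (sigmah dsigmah : R -> tensor_div R d) (vh dvh : R -> field R d 1 d).
Hypothesis hsigmah : C1_in Hh (Hdivnorm Om) T sigmah dsigmah.
Hypothesis hvh : C1_in Vh (@L2norm R d Om 1 d) T vh dvh.
Hypothesis hsemi1 : forall t, 0 <= t <= T -> forall tau, Hh tau ->
  a (dsigmah t).1 tau.1 + a (sigmah t).1 tau.1 + b (vh t) tau = 0.
Hypothesis hsemi2 : forall t, 0 <= t <= T -> forall w, Vh w ->
  c (dvh t) w - b w (sigmah t) = L2inner Om (f t) w.
Variables (sigmahat dsigmahat : R -> tensor_div R d) (vhat dvhat : R -> field R d 1 d).
Hypothesis hproj : elliptic_projection Om T rho Cinv f Hh Vh sigma dsigma dv sigmahat vhat.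
Hypothesis hdsigmahat : time_derivative Hh (Hdivnorm Om) T sigmahat dsigmahat.
Hypothesis hdvhat : time_derivative Vh (@L2norm R d Om 1 d) T vhat dvhat.

Let HhS : lin_subspace Hh. Proof. by case: hHh. Qed.
Let VhS : lin_subspace Vh. Proof. by case: hVh. Qed.
Let HhHdiv : Hh `<=` in_Hdiv Om. Proof. by case: hHh. Qed.
Let VhL2 : Vh `<=` L2f. Proof. by case: hVh. Qed.

(** e is the distance of the semi-discrete solution to the elliptic projection, r
    the consistency error and p the error of the projection.  The derivatives of e
    and p are de and r. *)
Let e t := ((sigmahat t).1 - (sigmah t).1, vhat t - vh t).
Let de t := ((dsigmahat t).1 - (dsigmah t).1, dvhat t - dvh t).
Let r t := ((dsigmahat t).1 - (dsigma t).1, dvhat t - dv t).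
Let p t := ((sigmahat t).1 - (sigma t).1, vhat t - v t).

Section at_time.
Variables (t : R) (tT : 0 <= t <= T).

Let Hs : in_Hdiv Om (sigma t). Proof. by case: hsigma => -[h _] _ _; exact: h. Qed.
Let Hds : in_Hdiv Om (dsigma t). Proof. by case: hsigma => _ h _; have [] := h t tT. Qed.
Let Vv : L2f (v t). Proof. by case: hv => -[h _] _ _; exact: h. Qed.
Let Vdv : L2f (dv t). Proof. by case: hv => _ h _; have [] := h t tT. Qed.
Let Hsh : Hh (sigmah t). Proof. by case: hsigmah => -[h _] _ _; exact: h. Qed.
Let Hdsh : Hh (dsigmah t). Proof. by case: hsigmah => _ h _; have [] := h t tT. Qed.
Let Vvh : Vh (vh t). Proof. by case: hvh => -[h _] _ _; exact: h. Qed.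
Let Vdvh : Vh (dvh t). Proof. by case: hvh => _ h _; have [] := h t tT. Qed.
Let Hsk : Hh (sigmahat t). Proof. by have [] := hproj tT. Qed.
Let Vvk : Vh (vhat t). Proof. by have [] := hproj tT. Qed.
Let Hdsk : Hh (dsigmahat t). Proof. by have [] := hdsigmahat tT. Qed.
Let Vdvk : Vh (dvhat t). Proof. by have [] := hdvhat tT. Qed.

Let sym tau : Hh tau -> symL2 Om tau.1. Proof. by move=> /HhHdiv; exact: in_Hdiv_sym. Qed.

Lemma error_members : [/\ X (e t), X (de t), X (r t) & X (p t)].
Proof.
have SS := si_subspace HS; have SV := si_subspace HV.
by split; split; apply: subspaceB => //; try exact: sym; try exact: VhL2;
  try exact: in_Hdiv_sym.
Qed.

Lemma error_terms_members : [/\ symL2 Om (sigmahat t).1, symL2 Om (dsigmahat t).1,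
  symL2 Om (sigmah t).1, symL2 Om (dsigmah t).1 & symL2 Om (sigma t).1] /\
  [/\ symL2 Om (dsigma t).1, L2f (vhat t), L2f (dvhat t), L2f (vh t) & L2f (dvh t)] /\
  L2f (v t) /\ L2f (dv t).
Proof.
split; first by split; try exact: sym; exact: in_Hdiv_sym.
by split=> //; split; try exact: VhL2; exact: in_Hdiv_sym.
Qed.

(** The difference tau = sigmahat - sigmah and w = vhat - vh are admissible test
    functions in the semi-discrete problem and in the equations of the projection.
    With these, b (w, tau) enters both equations with opposite signs, the load f
    cancels, and what remains on the right-hand side is a (tau, tau) >= 0. *)
Lemma error_inequality : B (de t) (e t) <= B (r t) (e t).
Proof.
pose tau := sigmahat t - sigmah t; pose w := vhat t - vh t.
have Htau : Hh tau by exact: subspaceB.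
have Vw : Vh w by exact: subspaceB.
have t1 : tau.1 = (sigmahat t).1 - (sigmah t).1 by [].
have s1 := hsemi1 tT Htau; have s2 := hsemi2 tT Vw.
have [_ _ /(_ _ Htau) p1 /(_ _ Vw)[p2 p3]] := hproj tT.
have stau := sym Htau; have Lw := VhL2 Vw.
rewrite /B /de /e /r /= -t1 -/w.
rewrite !(siBl Ha) ?(siBl Hc) //; try exact: sym; try exact: VhL2; try exact: in_Hdiv_sym.
have a0 := si_ge0 Ha stau.
rewrite {1}t1 (siBl Ha) // in a0; try exact: sym.
have bB : b (vhat t) tau - b (vh t) tau = b w tau.
  by rewrite /w [RHS](siBl HV) //; try exact: VhL2; exact: in_Hdiv_div (HhHdiv _).
have bB2 : b w tau = b w (sigmahat t) - b w (sigmah t).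
  have Ls := in_Hdiv_div (HhHdiv Hsk); have Lsh := in_Hdiv_div (HhHdiv Hsh).
  rewrite [LHS](si_sym HV) //; last exact: in_Hdiv_div (HhHdiv _).
  by rewrite [LHS](siBl HV) //; congr (_ - _); exact: (si_sym HV).
lra.
Qed.

End at_time.

Let nV_L2norm x : L2f x -> ((nV x)%:E <= L2norm Om x)%E.
Proof.
by move=> Lx; rewrite (L2norm_snorm mOm Lx).
Qed.

Let der_s : has_time_derivative T nS (fun t => (sigmahat t).1) (fun t => (dsigmahat t).1).
Proof.
apply: (time_derivative_snorm HS (pr := fst) _ L2norm_Hdivnorm _ _ hdsigmahat) => // t tT.
- by have [[]] := error_terms_members tT.
- by have [[]] := error_terms_members tT.
Qed.

Let der_v : has_time_derivative T nV vhat dvhat.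
Proof.
apply: (time_derivative_snorm HV (pr := id) _ nV_L2norm _ _ hdvhat) => // t tT.
- by have [_ [[]]] := error_terms_members tT.
- by have [_ [[]]] := error_terms_members tT.
Qed.

Let e_der : has_time_derivative T (snorm B) e de.
Proof.
have der_sh : has_time_derivative T nS (fun t => (sigmah t).1) (fun t => (dsigmah t).1).
  case: hsigmah => _ h _.
  apply: (time_derivative_snorm HS (pr := fst) _ L2norm_Hdivnorm _ _ h) => // t tT.
  - by have [[]] := error_terms_members tT.
  - by have [[]] := error_terms_members tT.
have der_vh : has_time_derivative T nV vh dvh.
  case: hvh => _ h _.
  apply: (time_derivative_snorm HV (pr := id) _ nV_L2norm _ _ h) => // t tT.
  - by have [_ [[]]] := error_terms_members tT.
  - by have [_ [[]]] := error_terms_members tT.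
refine (@has_time_derivative_pair R T _ _ (symL2 Om) L2f nS nV (snorm B) (Num.sqrt c1)
  (fun t => (sigmahat t).1 - (sigmah t).1) (fun t => (dsigmahat t).1 - (dsigmah t).1)
  (fun t => vhat t - vh t) (fun t => dvhat t - dvh t) _ _ _ _ _ _ _ _).
- exact: si_subspace HS.
- exact: si_subspace HV.
- by rewrite sqrtr_gt0.
- move=> x y Xx Xy; apply: le_trans (snormB_le _) _ => //.
  by rewrite ler_wpM2l ?sqrtr_ge0 // snormP_le.
- by move=> t tT; have [[? ?] [? ?] _ _] := error_members tT.
- by move=> t tT; have [[? ?] [? ?] _ _] := error_members tT.
- apply: (has_time_derivativeB HS _ der_s der_sh) => t tT.
  by have [[]] := error_terms_members tT.
- apply: (has_time_derivativeB HV _ der_v der_vh) => t tT.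
  by have [_ [[]]] := error_terms_members tT.
Qed.

Let p_der : has_time_derivative T (snorm P) p r.
Proof.
have der_sh : has_time_derivative T nS (fun t => (sigma t).1) (fun t => (dsigma t).1).
  case: hsigma => _ h _.
  apply: (time_derivative_snorm HS (pr := fst) _ L2norm_Hdivnorm _ _ h) => // t tT.
  - by have [[]] := error_terms_members tT.
  - by have [_ [[]]] := error_terms_members tT.
have der_vh : has_time_derivative T nV v dv.
  case: hv => _ h _.
  apply: (time_derivative_snorm HV (pr := id) _ nV_L2norm _ _ h) => // t tT.
  - by have [_ [_ []]] := error_terms_members tT.
  - by have [_ [_ []]] := error_terms_members tT.
refine (@has_time_derivative_pair R T _ _ (symL2 Om) L2f nS nV (snorm P) 1
  (fun t => (sigmahat t).1 - (sigma t).1) (fun t => (dsigmahat t).1 - (dsigma t).1)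
  (fun t => vhat t - v t) (fun t => dvhat t - dv t) _ _ _ _ _ _ _ _).
- exact: si_subspace HS.
- exact: si_subspace HV.
- exact: ltr01.
- by move=> x y Xx Xy; rewrite mul1r snormP_le.
- by move=> t tT; have [_ _ [? ?] [? ?]] := error_members tT.
- by move=> t tT; have [_ _ [? ?] [? ?]] := error_members tT.
- apply: (has_time_derivativeB HS _ der_s der_sh) => t tT.
  by have [[? ? ? ? ?] [[]]] := error_terms_members tT.
- apply: (has_time_derivativeB HV _ der_v der_vh) => t tT.
  by have [_ [[? ? ? ? ?] []]] := error_terms_members tT.
Qed.

(** A1 bounds the error of the projection, A2 the error of the initial data, and
    G the integral of the square of the consistency error. *)
Lemma semidiscrete_error (A1 A2 G : R) (g : R -> \bar R) :
  {ae @lebesgue_measure R, forall t, 0 <= t <= T ->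
     nS ((sigmahat t).1 - (sigma t).1) + nV (vhat t - v t) <= A1} ->
  nS ((sigma 0).1 - (sigmah 0).1) + nV (v 0 - vh 0) <= A2 ->
  measurable_fun `[0, T] g -> (forall t, 0 <= g t)%E ->
  {ae @lebesgue_measure R, forall t, 0 <= t <= T ->
     (((nS ((dsigmahat t).1 - (dsigma t).1) + nV (dvhat t - dv t)) ^+ 2)%:E <= g t)%E} ->
  (\int[@lebesgue_measure R]_(t in `[0%R, T]) g t <= G%:E)%E ->
  {ae @lebesgue_measure R, forall t, 0 <= t <= T ->
     nS ((sigma t).1 - (sigmah t).1) <=
       A1 + Num.sqrt (c1 / c0 * (2 * (A1 + A2) ^+ 2 + 4 * T * G)) /\
     nV (v t - vh t) <=
       A1 + Num.sqrt (c1 / c0 * (2 * (A1 + A2) ^+ 2 + 4 * T * G))}.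
Proof.
move=> hA1 hA2 mg g0 rg gG.
have zT : 0 <= (0 : R) <= T by rewrite lexx ltW.
have p0 : snorm P (p 0) <= A1.
  apply: (snorm_le_initial HP T0 _ p_der) => [t tT|].
    by have [] := error_members tT.
  apply: lebesgue_ae_mono hA1 => t h tT; apply: le_trans (h tT).
  by have [_ _ _ [? ?]] := error_members tT; exact: snormP_le.
have e0 : snorm P (e 0) <= A1 + A2.
  have [Xe0 _ _ Xp0] := error_members zT.
  have [[s1 _ s3 _ s5] [[_ v2 _ v4 _] [v6 _]]] := error_terms_members zT.
  have Xq : X ((sigma 0).1 - (sigmah 0).1, v 0 - vh 0).
    by split; [exact: subspaceB (si_subspace HS) _ _|exact: subspaceB (si_subspace HV) _ _].
  have -> : e 0 = p 0 + ((sigma 0).1 - (sigmah 0).1, v 0 - vh 0).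
    by congr pair; rewrite /= addrA subrK.
  apply: le_trans (snormD HP Xp0 Xq) _; apply: lerD => //.
  by apply: le_trans hA2; apply: snormP_le; case: Xq.
have A0 : 0 <= A1 + A2 by rewrite (le_trans _ e0) // snorm_ge0.
have key t : 0 <= t <= T ->
    snorm P (e t) <= Num.sqrt (c1 / c0 * (2 * (A1 + A2) ^+ 2 + 4 * T * G)).
  move=> tT; have [Xe _ _ _] := error_members tT.
  apply: ler_wsqrtr.
  have : ((B (e t) (e t))%:E <= (2 * B (e 0) (e 0))%:E +
     (4 * T)%:E * \int[@lebesgue_measure R]_(s in `[0%R, T]) (c1%:E * g s))%E.
    apply: (energy_estimate HB T0 _ _ _ e_der (r := r)) => //.
    - by move=> s sT; have [] := error_members sT.
    - by move=> s sT; have [] := error_members sT.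
    - by move=> s sT; have [] := error_members sT.
    - by move=> s sT; exact: error_inequality.
    - exact: measurable_funeM.
    - by move=> s; rewrite mule_ge0 // lee_fin ltW.
    apply: lebesgue_ae_mono rg => s h sT.
    have [_ _ Xr _] := error_members sT.
    apply: (@le_trans _ _ (c1 * P (r s) (r s))%:E).
      by rewrite lee_fin; have /andP[] := B_bounds Xr.
    rewrite EFinM lee_pmul2l // (le_trans _ (h sT)) // lee_fin.
    rewrite -(snorm_sqr HP Xr) lerXn2r ?nnegrE ?addr_ge0 ?snorm_ge0 //.
    by case: Xr => ? ?; exact: snormP_le.
  rewrite ge0_integralZl //; last by rewrite lee_fin ltW.
  move=> h; have {h} : ((B (e t) (e t))%:E <= (2 * B (e 0) (e 0))%:E +
     (4 * T)%:E * (c1%:E * G%:E))%E.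
    apply: le_trans h _; rewrite leeD2l // lee_pmul2l ?lte_fin ?mulr_gt0 //.
    by rewrite lee_pmul2l ?lte_fin.
  rewrite -!EFinM -EFinD lee_fin => h.
  have [Xe0 _ _ _] := error_members zT.
  have /andP[Bl _] := B_bounds Xe; have /andP[_ Bu] := B_bounds Xe0.
  have e02 : P (e 0) (e 0) <= (A1 + A2) ^+ 2.
    by rewrite -(snorm_sqr HP Xe0) lerXn2r ?nnegrE ?snorm_ge0.
  rewrite mulrAC ler_pdivlMr // mulrC; apply: le_trans Bl _; apply: le_trans h _.
  rewrite [X in _ <= X]mulrDr; apply: lerD; last by rewrite mulrCA.
  by rewrite mulrCA ler_pM2l //; apply: le_trans Bu _; rewrite ler_pM2l.
apply: lebesgue_ae_mono hA1 => t h tT; have {}h := h tT.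
have [Xe _ _ Xp] := error_members tT; have k := key t tT.
have [[s1 _ s3 _ s5] [[_ v2 _ v4 _] [v6 _]]] := error_terms_members tT.
have SS := si_subspace HS; have SV := si_subspace HV.
split.
- have -> : (sigma t).1 - (sigmah t).1 = (e t).1 - (p t).1.
    by rewrite opprB [RHS]addrC addrA subrK.
  apply: le_trans (snormB HS _ _) _; [by case: Xe|by case: Xp|].
  rewrite addrC; apply: lerD; last exact: le_trans (nS_le Xe) k.
  by apply: le_trans h; rewrite lerDl snorm_ge0.
- have -> : v t - vh t = (e t).2 - (p t).2.
    by rewrite opprB [RHS]addrC addrA subrK.
  apply: le_trans (snormB HV _ _) _; [by case: Xe|by case: Xp|].
  rewrite addrC; apply: lerD; last exact: le_trans (nV_le Xe) k.
  by apply: le_trans h; rewrite lerDr snorm_ge0.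
Qed.

End discretization.

(** * Semi-inner products *)
(** * The error bound *)

Lemma mesh_size_ge0 (R : realType) (d : nat) (Th : seq (set 'rV[R]_d)) :
  0 <= mesh_size Th.
Proof. by rewrite /mesh_size; elim/big_rec: _ => // K x _ x0; rewrite le_max x0 orbT. Qed.

Lemma L2norm_ae_eq (R : realType) (d p q : nat) (Om : set 'rV[R]_d) (f g : field R d p q) :
  measurable Om -> in_L2 Om f -> in_L2 Om g ->
  {ae lebesgue_rV R d, forall x, Om x -> f x = g x} -> L2norm Om f = L2norm Om g.
Proof.
move=> mOm fL gL fg; rewrite !L2normE; congr (_ `^ _)%E.
have /integrableP[mf _] := L2_integrable_frob mOm fL fL.
have /integrableP[mg _] := L2_integrable_frob mOm gL gL.
apply: ae_eq_integral => //.
by apply: filterS fg => x h Ox /=; rewrite h.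
Qed.

Lemma finite_ge0 (R : realType) (x : \bar R) : (0 <= x)%E -> (x < +oo)%E ->
  exists2 r : R, 0 <= r & x = r%:E.
Proof.
case: x => // r; rewrite lee_fin => r0 _; by exists r.
Qed.

Lemma sqr_mulD_le (R : realType) (z x y : R) :
  (z * (x + y)) ^+ 2 <= 2 * z ^+ 2 * (x * x + y * y).
Proof. by have := sqr_ge0 (z * (x - y)); nra. Qed.

(** Every term on the left is homogeneous of degree one in h and in the norms
    S1, S2, D1, D2, I1, I2, each of which is at most their sum. *)
Lemma error_constant_le (R : realType) (c T K1 K2 K3 K4 h S1 S2 D1 D2 I1 I2 : R) :
  0 <= c -> 0 < T -> 0 <= K1 -> 0 <= K2 -> 0 <= K3 -> 0 <= K4 -> 0 <= h ->
  0 <= S1 -> 0 <= S2 -> 0 <= D1 -> 0 <= D2 -> 0 <= I1 -> 0 <= I2 ->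
  K1 * h * (S1 + S2) + Num.sqrt (c *
    (2 * (K1 * h * (S1 + S2) + (K3 * h * I1 + K4 * h * I2)) ^+ 2 +
     4 * T * (2 * (K2 * h) ^+ 2 * (D1 * D1 + D2 * D2)))) <=
  (K1 + Num.sqrt (c * (2 * (K1 + K3 + K4) ^+ 2 + 8 * T * K2 ^+ 2))) *
    (h * (I1 + I2 + S1 + D1 + S2 + D2)).
Proof.
move=> c0 T0 K10 K20 K30 K40 h0 S10 S20 D10 D20 I10 I20.
set Sg := I1 + I2 + S1 + D1 + S2 + D2; set k := K1 + K3 + K4.
have hS0 : 0 <= h * Sg by rewrite mulr_ge0 // !addr_ge0.
have part K x : 0 <= K -> x <= Sg -> K * h * x <= K * (h * Sg).
  by move=> K0 xS; rewrite -mulrA !ler_wpM2l.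
have a1 : K1 * h * (S1 + S2) <= K1 * (h * Sg) by apply: part => //; rewrite /Sg; lra.
have a2 : K3 * h * I1 <= K3 * (h * Sg) by apply: part => //; rewrite /Sg; lra.
have a3 : K4 * h * I2 <= K4 * (h * Sg) by apply: part => //; rewrite /Sg; lra.
have a4 : D1 * D1 + D2 * D2 <= Sg ^+ 2.
  apply: (@le_trans _ _ ((D1 + D2) ^+ 2)).
    by rewrite sqrrD -!expr2 -addrA lerD2l lerDr mulrn_wge0 // mulr_ge0.
  by rewrite lerXn2r ?nnegrE ?addr_ge0 // /Sg; lra.
rewrite [X in _ <= X]mulrDl; apply: lerD => //.
rewrite -[X in _ <= _ * X](ger0_norm hS0) -sqrtr_sqr -sqrtrM; last first.
  apply: mulr_ge0 => //; apply: addr_ge0; first by rewrite mulr_ge0 // sqr_ge0.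
  by apply: mulr_ge0; [rewrite mulr_ge0 // ltW|exact: sqr_ge0].
apply: ler_wsqrtr; rewrite -[X in _ <= X]mulrA; apply: ler_wpM2l => //.
rewrite [X in _ <= X]mulrDl; apply: lerD.
  rewrite -[X in _ <= X]mulrA -exprMn; apply: ler_wpM2l => //.
  rewrite lerXn2r ?nnegrE //.
  - by rewrite !addr_ge0 // !mulr_ge0 // addr_ge0.
  - by rewrite mulr_ge0 // !addr_ge0.
  - by rewrite !mulrDl -addrA lerD // lerD.
have -> : 4 * T * (2 * (K2 * h) ^+ 2 * (D1 * D1 + D2 * D2)) =
  8 * T * K2 ^+ 2 * (h ^+ 2 * (D1 * D1 + D2 * D2)) by ring.
rewrite exprMn; apply: ler_wpM2l.
  by apply: mulr_ge0; [rewrite mulr_ge0 // ltW|exact: sqr_ge0].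
by rewrite ler_wpM2l ?sqr_ge0.
Qed.

Theorem theorem3p1 (R : realType) (d : nat) (hd : d = 2%N \/ d = 3%N)
  (Om : set 'rV[R]_d) (hOm : convex_polyhedral_domain Om)
  (T : R) (hT : 0 < T)
  (rho : 'rV[R]_d -> R) (rho0 rho1 : R) (hrho : density Om rho rho0 rho1)
  (C Cinv : 'rV[R]_d -> tensor4 R d) (M0 M1 : R)
  (hC : elasticity_tensor Om C Cinv M0 M1)
  (f : R -> field R d 1 d)
  (hf : continuous_in (@in_L2 R d Om 1 d) (@L2norm R d Om 1 d) T f)
  (* the weak solution *)
  (psi0 : tensor_div R d) (hpsi0 : in_Hdiv Om psi0)
  (phi1 : field R d 1 d) (hphi1 : in_L2 Om phi1)
  (sigma dsigma : R -> tensor_div R d) (v dv : R -> field R d 1 d)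
  (hsigma : C1_in (in_Hdiv Om) (Hdivnorm Om) T sigma dsigma)
  (hv : C1_in (@in_L2 R d Om 1 d) (@L2norm R d Om 1 d) T v dv)
  (hweak : evolution_problem Om T rho Cinv f
             (in_Hdiv Om) (@in_L2 R d Om 1 d) psi0 phi1 sigma dsigma v dv)
  (* a family of partitions, with spaces, interpolation operators and
     semi-discrete solutions *)
  (I : Type) (Th : I -> seq (set 'rV[R]_d))
  (hTh : forall i, partition_of Om (Th i))
  (hreg : exists kappa : R, forall i, shape_regular kappa (Th i))
  (Hh : I -> set (tensor_div R d)) (Vh : I -> set (field R d 1 d))
  (hHh : forall i, finite_dim_subspace (in_Hdiv Om) (Hdivnorm Om) (Hh i))
  (hVh : forall i, finite_dim_subspace (@in_L2 R d Om 1 d) (@L2norm R d Om 1 d) (Vh i))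
  (IH : I -> tensor_div R d -> tensor_div R d)
  (hIH : forall i tau, in_Hdiv Om tau -> Hh i (IH i tau))
  (IV : I -> field R d 1 d -> field R d 1 d)
  (hIV : forall i w, in_L2 Om w -> Vh i (IV i w))
  (sigmah dsigmah : I -> R -> tensor_div R d)
  (vh dvh : I -> R -> field R d 1 d)
  (hsigmah : forall i, C1_in (Hh i) (Hdivnorm Om) T (sigmah i) (dsigmah i))
  (hvh : forall i, C1_in (Vh i) (@L2norm R d Om 1 d) T (vh i) (dvh i))
  (hsemi : forall i, evolution_problem Om T rho Cinv f
             (Hh i) (Vh i) (IH i psi0) (IV i phi1)
             (sigmah i) (dsigmah i) (vh i) (dvh i))
  (l m m' : nat)
  (hinfsup : exists K : R, forall i, inf_sup Om (Hh i) (Vh i) K)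
  (* regularity *)
  (hsigma_m : in_Lp (@in_H R d Om d d m) (@Hnorm R d Om d d m) T +oo%E
                (fun t => (sigma t).1))
  (hdsigma_m : in_Lp (@in_H R d Om d d m) (@Hnorm R d Om d d m) T 2%:E
                 (fun t => (dsigma t).1))
  (hv_m' : in_Lp (@in_H R d Om 1 d m') (@Hnorm R d Om 1 d m') T +oo%E v)
  (hdv_m' : in_Lp (@in_H R d Om 1 d m') (@Hnorm R d Om 1 d m') T 2%:E dv)
  (* the elliptic projection and its time derivative *)
  (sigmahat dsigmahat : I -> R -> tensor_div R d)
  (vhat dvhat : I -> R -> field R d 1 d)
  (hproj : forall i, elliptic_projection Om T rho Cinv f (Hh i) (Vh i)
             sigma dsigma dv (sigmahat i) (vhat i))
  (hdsigmahat : forall i, time_derivative (Hh i) (Hdivnorm Om) T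
                  (sigmahat i) (dsigmahat i))
  (hdvhat : forall i, time_derivative (Vh i) (@L2norm R d Om 1 d) T
              (vhat i) (dvhat i))
  (happrox : exists K : R, forall i,
     {ae @lebesgue_measure R, forall t, 0 <= t <= T ->
       (L2norm Om ((sigmahat i t).1 - (sigma t).1)%R +
          L2norm Om (vhat i t - v t)%R
        <= (K * mesh_size (Th i) ^+ l)%:E *
           (Hnorm Om m (sigma t).1 + Hnorm Om m' (v t)))%E})
  (hdapprox : exists K : R, forall i,
     {ae @lebesgue_measure R, forall t, 0 <= t <= T ->
       (L2norm Om ((dsigmahat i t).1 - (dsigma t).1)%R +
          L2norm Om (dvhat i t - dv t)%R
        <= (K * mesh_size (Th i) ^+ l)%:E *
           (Hnorm Om m (dsigma t).1 + Hnorm Om m' (dv t)))%E})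
  (* the interpolation estimate *)
  (hpsi0_l : in_H Om l psi0.1) (hphi1_l : in_H Om l phi1)
  (hinterp_psi0 : exists K : R, forall i,
     (L2norm Om (psi0.1 - (IH i psi0).1)%R
      <= (K * mesh_size (Th i) ^+ l)%:E * Hnorm Om l psi0.1)%E)
  (hinterp_phi1 : exists K : R, forall i,
     (L2norm Om (phi1 - IV i phi1)%R
      <= (K * mesh_size (Th i) ^+ l)%:E * Hnorm Om l phi1)%E) :
  exists K : R, 0 < K /\ forall i : I,
    (Lp_norm (@L2norm R d Om d d) T +oo (fun t => (sigma t).1 - (sigmah i t).1)%R +
     Lp_norm (@L2norm R d Om 1 d) T +oo (fun t => v t - vh i t)%R
     <= (K * mesh_size (Th i) ^+ l)%:E *
        (Hnorm Om l psi0.1 + Hnorm Om l phi1 +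
         Lp_norm (@Hnorm R d Om d d m) T +oo (fun t => (sigma t).1) +
         Lp_norm (@Hnorm R d Om d d m) T 2%:E (fun t => (dsigma t).1) +
         Lp_norm (@Hnorm R d Om 1 d m') T +oo v +
         Lp_norm (@Hnorm R d Om 1 d m') T 2%:E dv))%E.
Proof.
have mOm := measurable_convex_polyhedral hOm.
have bOm : exists M : R, forall x, Om x -> fnorm x <= M by case: hOm.
case: happrox => [Ka happrox']; case: hdapprox => [Kd hdapprox'].
case: hinterp_psi0 => [Kp hpsi]; case: hinterp_phi1 => [Kf hphi].
(* The given constants may be negative. *)
pose K1 := Num.max Ka 0; pose K2 := Num.max Kd 0.
pose K3 := Num.max Kp 0; pose K4 := Num.max Kf 0.
have K10 : 0 <= K1 by rewrite le_max lexx orbT.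
have K20 : 0 <= K2 by rewrite le_max lexx orbT.
have K30 : 0 <= K3 by rewrite le_max lexx orbT.
have K40 : 0 <= K4 by rewrite le_max lexx orbT.
have HS0 := @Hnorm_ge0 R d Om d d m; have HV0 := @Hnorm_ge0 R d Om 1 d m'.
have [aeS bS fS] := hsigma_m; have [aedS bdS fdS] := hdsigma_m.
have [aeV bV fV] := hv_m'; have [aedV bdV fdV] := hdv_m'.
have [S1 S10 S1E] := finite_ge0 (Lp_norm_ge0 _ _ _ _) fS.
have [D1 D10 D1E] := finite_ge0 (Lp_norm_ge0 _ _ _ _) fdS.
have [S2 S20 S2E] := finite_ge0 (Lp_norm_ge0 _ _ _ _) fV.
have [D2 D20 D2E] := finite_ge0 (Lp_norm_ge0 _ _ _ _) fdV.
have [I1 I10 I1E] := finite_ge0 (Hnorm_ge0 _ _ _) (Hnorm_lty mOm hpsi0_l).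
have [I2 I20 I2E] := finite_ge0 (Hnorm_ge0 _ _ _) (Hnorm_lty mOm hphi1_l).
have [A [mA A0 aeA intA]] := bochner_sqr_majorant HS0 (Hnorm0 mOm _ _ _) (@HnormB R d Om mOm bOm d d m)
  (lebesgue_ae_mono (fun t h tT => Hnorm_lty mOm (h tT)) aedS) bdS.
have [A' [mA' A'0 aeA' intA']] := bochner_sqr_majorant HV0 (Hnorm0 mOm _ _ _) (@HnormB R d Om mOm bOm 1 d m')
  (lebesgue_ae_mono (fun t h tT => Hnorm_lty mOm (h tT)) aedV) bdV.
rewrite D1E D2E in intA intA' *; rewrite S1E S2E I1E I2E.
pose Sg := I1 + I2 + S1 + D1 + S2 + D2.
have Sg0 : 0 <= Sg by rewrite !addr_ge0.
pose c01 := Num.max M1 rho1 / Num.min M0 rho0.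
pose k := K1 + K3 + K4.
pose q := Num.sqrt (c01 * (2 * k ^+ 2 + 8 * T * K2 ^+ 2)).
have q0 : 0 <= q by exact: sqrtr_ge0.
have c010 : 0 <= c01.
  apply: divr_ge0; rewrite ?le_max ?le_min.
    by case: hC => _ _ _ M10 _; rewrite (ltW M10).
  by case: hC => _ _ M00 _ _; case: hrho => _ r00 _; rewrite !ltW.
exists (2 * (K1 + q) + 1); split; first by rewrite ltr_wpDl // mulr_ge0 // addr_ge0.
move=> i; set h := mesh_size (Th i) ^+ l.
have h0 : 0 <= h by rewrite exprn_ge0 // mesh_size_ge0.
have maxK (a : R) (x y : \bar R) : (0 <= y)%E -> (x <= (a * h)%:E * y)%E ->
    (x <= (Num.max a 0 * h)%:E * y)%E.
  move=> y0 /le_trans; apply; apply: lee_wpmul2r => //.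
  by rewrite lee_fin ler_wpM2r // le_max lexx.
have [hw1 hw2 hw3 hw4] := hweak; have [hs1 hs2 hs3 hs4] := hsemi i.
have zT : 0 <= (0 : R) <= T by rewrite lexx ltW.
have terms t : 0 <= t <= T -> _ := fun tT =>
  error_terms_members hsigma hv (hHh i) (hVh i) (hsigmah i) (hvh i)
    (hproj i) (hdsigmahat i) (hdvhat i) tT.
have L2S := in_L2_subspace mOm d d; have L2V := in_L2_subspace mOm 1 d.
(* The square of K2 h (|sigma_t|_m + |v_t|_m') is at most g t for almost all t. *)
pose g t := ((2 * (K2 * h) ^+ 2)%:E * (A t * A t + A' t * A' t))%E.
have sqK0 : 0 <= 2 * (K2 * h) ^+ 2 by rewrite mulr_ge0 // sqr_ge0.
have F1 : {ae @lebesgue_measure R, forall t, 0 <= t <= T ->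
    snorm (@L2ip R d Om d d) ((sigmahat i t).1 - (sigma t).1) +
    snorm (@L2ip R d Om 1 d) (vhat i t - v t) <= K1 * h * (S1 + S2)}.
  have aeL := lebesgue_ae_and (ae_le_Lp_norm_pinfty T HS0 (fun t => (sigma t).1))
    (ae_le_Lp_norm_pinfty T HV0 v).
  apply: lebesgue_ae_mono (lebesgue_ae_and (happrox' i) aeL) => t [ht [hS hV]] tT.
  have [[[s1 _] _ _ _ [s5 _]] [[_ v2 _ _ _] [v6 _]]] := terms t tT.
  rewrite -lee_fin EFinD -!(L2norm_snorm mOm); last 2 first.
  - exact: subspaceB.
  - exact: subspaceB.
  apply: le_trans (maxK _ _ _ _ (ht tT)) _; first exact: adde_ge0.
  rewrite [X in (_ <= X)%E]EFinM EFinD -S1E -S2E; apply: lee_wpmul2l.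
    by rewrite lee_fin mulr_ge0.
  by apply: leeD; [exact: hS|exact: hV].
have F2 : snorm (@L2ip R d Om d d) ((sigma 0).1 - (sigmah i 0).1) +
    snorm (@L2ip R d Om 1 d) (v 0 - vh i 0) <= K3 * h * I1 + K4 * h * I2.
  have [[_ _ [s3 _] _ [s5 _]] [[_ _ _ v4 _] [v6 _]]] := terms 0 zT.
  have [IHL _ _ _] : in_Hdiv Om (IH i psi0) by case: (hHh i) => + _ _ _; apply; exact: hIH.
  have IVL : in_L2 Om (IV i phi1) by case: (hVh i) => + _ _ _; apply; exact: hIV.
  have psiL : in_L2 Om psi0.1 by case: hpsi0.
  rewrite -lee_fin !EFinD -!(L2norm_snorm mOm); last 2 first.
  - exact: subspaceB.
  - exact: subspaceB.
  apply: leeD.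
  - rewrite (@L2norm_ae_eq _ _ _ _ _ _ (psi0.1 - (IH i psi0).1)) //; last 3 first.
    + exact: subspaceB.
    + exact: subspaceB.
    + by apply: filterS2 hw4 hs4 => x e1 e2 Ox;
        rewrite -[LHS]/((sigma 0).1 x - (sigmah i 0).1 x) e1 // e2.
    by rewrite [X in (_ <= X)%E]EFinM -I1E; apply: maxK (hpsi i); exact: Hnorm_ge0.
  - rewrite (@L2norm_ae_eq _ _ _ _ _ _ (phi1 - IV i phi1)) //; last 3 first.
    + exact: subspaceB.
    + exact: subspaceB.
    + by apply: filterS2 hw3 hs3 => x e1 e2 Ox;
        rewrite -[LHS]/(v 0 x - vh i 0 x) e1 // e2.
    by rewrite [X in (_ <= X)%E]EFinM -I2E; apply: maxK (hphi i); exact: Hnorm_ge0.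
have mAA : measurable_fun setT (fun t => A t * A t)%E by exact: emeasurable_funM.
have mAA' : measurable_fun setT (fun t => A' t * A' t)%E by exact: emeasurable_funM.
have mg : measurable_fun setT g.
  by apply: measurable_funeM; exact: emeasurable_funD.
have AA0 t : (0 <= A t * A t)%E by exact: mule_ge0.
have AA'0 t : (0 <= A' t * A' t)%E by exact: mule_ge0.
have g0 t : (0 <= g t)%E.
  by rewrite mule_ge0 ?lee_fin // adde_ge0.
have F5 : {ae @lebesgue_measure R, forall t, 0 <= t <= T ->
    (((snorm (@L2ip R d Om d d) ((dsigmahat i t).1 - (dsigma t).1) +
    snorm (@L2ip R d Om 1 d) (dvhat i t - dv t)) ^+ 2)%:E <= g t)%E}.
  apply: lebesgue_ae_mono (lebesgue_ae_and (hdapprox' i) (lebesgue_ae_and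
    (lebesgue_ae_and aedS aedV) (lebesgue_ae_and aeA aeA'))) => t.
  move=> [ht [[hS hV] [EA EA']]] tT.
  have [[_ [s2 _] _ _ _] [[[s6 _] _ v3 _ _] [_ v7]]] := terms t tT.
  have [x x0 xE] := finite_ge0 (HS0 _) (Hnorm_lty mOm (hS tT)).
  have [y y0 yE] := finite_ge0 (HV0 _) (Hnorm_lty mOm (hV tT)).
  have xy0 : (0 <= x%:E + y%:E)%E by rewrite adde_ge0 ?lee_fin.
  have := maxK _ _ _ _ (ht tT); rewrite xE yE => /(_ xy0).
  rewrite !(L2norm_snorm mOm); [|exact: subspaceB..].
  rewrite -!EFinD -EFinM lee_fin => hxy.
  rewrite /g (EA tT) (EA' tT) xE yE.
  rewrite [X in (_ <= X)%E](_ : _ = (2 * (K2 * h) ^+ 2 * (x * x + y * y))%:E) // lee_fin.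
  have h1 : 0 <= K2 * h by rewrite mulr_ge0.
  apply: (@le_trans _ _ ((K2 * h * (x + y)) ^+ 2)).
    by rewrite lerXn2r ?nnegrE ?addr_ge0 ?snorm_ge0 // !mulr_ge0 // addr_ge0.
  exact: sqr_mulD_le.
have F6 : (\int[@lebesgue_measure R]_(t in `[0%R, T]) g t <=
    (2 * (K2 * h) ^+ 2 * (D1 * D1 + D2 * D2))%:E)%E.
  apply: (@le_trans _ _ (\int[@lebesgue_measure R]_t g t)%E).
    exact: ge0_subset_integral.
  rewrite ge0_integralZl //; last 2 first.
  - exact: emeasurable_funD.
  - by move=> t _; exact: adde_ge0.
  rewrite [X in (_ <= X)%E]EFinM; apply: lee_wpmul2l; first by rewrite lee_fin.
  rewrite ge0_integralD // EFinD.
  by apply: leeD.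
have main := semidiscrete_error mOm hT hrho hC hsigma hv (hHh i) (hVh i) (hsigmah i)
  (hvh i) hs1 hs2 (hproj i) (hdsigmahat i) (hdvhat i) F1 F2 (measurable_funTS mg) g0 F5 F6.
pose Q := K1 * h * (S1 + S2) + Num.sqrt (c01 *
  (2 * (K1 * h * (S1 + S2) + (K3 * h * I1 + K4 * h * I2)) ^+ 2 +
   4 * T * (2 * (K2 * h) ^+ 2 * (D1 * D1 + D2 * D2)))).
have Q0 : 0 <= Q by rewrite addr_ge0 ?sqrtr_ge0 // !mulr_ge0 // addr_ge0.
have QS : Q <= (K1 + q) * (h * Sg) by exact: error_constant_le.
have bound : (Lp_norm (@L2norm R d Om d d) T +oo (fun t => (sigma t).1 - (sigmah i t).1)%R +
     Lp_norm (@L2norm R d Om 1 d) T +oo (fun t => v t - vh i t)%R <= Q%:E + Q%:E)%E.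
  apply: leeD; apply: Lp_norm_pinfty_le; rewrite ?lee_fin //; try by move=> *; exact: L2norm_ge0.
  - apply: lebesgue_ae_mono main => t ht tT; have [hS _] := ht tT.
    have [[_ _ [s3 _] _ [s5 _]] _] := terms t tT.
    by rewrite (L2norm_snorm mOm) ?lee_fin //; exact: subspaceB.
  - apply: lebesgue_ae_mono main => t ht tT; have [_ hV] := ht tT.
    have [_ [[_ _ _ v4 _] [v6 _]]] := terms t tT.
    by rewrite (L2norm_snorm mOm) ?lee_fin //; exact: subspaceB.
apply: le_trans bound _; rewrite -!EFinD -EFinM lee_fin.
have hS0 : 0 <= h * Sg by rewrite mulr_ge0.
rewrite [X in _ <= X](_ : _ = (K1 + q) * (h * Sg) + (K1 + q) * (h * Sg) + h * Sg).
  by rewrite -[X in X <= _]addr0; apply: lerD => //; exact: lerD.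
by rewrite /Sg; ring.
Qed.
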